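(* Let $L\subset\mathbb{Z}^n$ be a lattice. The ideal $I_L$ is a binomial complete intersection if and only if $I_{L^\sigma}$ is a complete intersection.
   Context: Let $\Bbbk$ be a field, $\mathbb{N}=\mathbb{Z}_{\ge0}$. A lattice is a subgroup $L\subset\mathbb{Z}^n$; its lattice ideal is $I_L=\langle x^u-x^v:u,v\in\mathbb{N}^n,\ u-v\in L\rangle\subset\Bbbk[x_1,\ldots,x_n]$. Let $\sigma=\bigcup_{w\in L\cap\mathbb{N}^n}\operatorname{supp}(w)\subset\{1,\dots,n\}$, where $\operatorname{supp}(w)=\{i:w_i\ne0\}$. For $u\in\mathbb{Z}^n$, $u^\sigma=(u_i)_{i\notin\sigma}$ (with $u^\sigma=0$ if $\sigma=\{1,\dots,n\}$). $L^\sigma$ is the lattice generated by the vectors $u^\sigma$, $u\in L$, and $I_{L^\sigma}$ is its lattice ideal in $\Bbbk[x_i:i\notin\sigma]$ (if $L^\sigma=\{0\}$ then $I_{L^\sigma}=0$). A lattice ideal of height $r$ is a complete intersection if it can be generated by $r$ polynomials, and a binomial complete intersection if it can be generated by $r$ binomials, where a binomial means a difference $x^u-x^v$ of two distinct monomials. *)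

(* Defs.v *)
From HB Require Import structures.
From mathcomp Require Import all_boot all_order all_algebra.
From mathcomp Require Import boolp.
From mathcomp Require Export mpoly.

Set Implicit Arguments.
Unset Strict Implicit.
Unset Printing Implicit Defensive.

Import GRing.Theory.
Local Open Scope ring_scope.

Definition zmod_gen (V : zmodType) (S : {pred V}) : {pred V} :=
  [pred v | `[< exists2 s : seq (int * V),
                  {in s, forall p, p.2 \in S}
                & v = \sum_(p <- s) p.2 *~ p.1 >]].

Definition ideal_gen (R : comNzRingType) (S : {pred R}) : {pred R} :=
  [pred f | `[< exists2 s : seq (R * R),
                  {in s, forall p, p.2 \in S}
                & f = \sum_(p <- s) p.1 * p.2 >]].

Section Height.
Variable R : comNzRingType.
Implicit Types P I : {pred R}.

(* [idealr_closed] already requires the ideal to be proper. *)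
Definition is_prime_ideal P : Prop := idealr_closed P /\ prime_idealr_closed P.

(* A strictly increasing chain p 0 < p 1 < ... < p d = P of prime ideals,
   of length d; only the values p 0, ..., p d matter. *)
Definition prime_chain P (d : nat) : Prop :=
  exists p : nat -> {pred R},
    [/\ forall i, (i <= d)%N -> is_prime_ideal (p i),
        forall i, (i < d)%N ->
          {subset p i <= p i.+1} /\ ~ {subset p i.+1 <= p i}
      & p d =i P].

Definition prime_height P (h : nat) : Prop :=
  prime_chain P h /\ forall d, prime_chain P d -> (d <= h)%N.

(* Primes of infinite height satisfy [prime_height P d] for no d, hence are
   ignored by this minimum, as they should be. *)
Definition ideal_height I (h : nat) : Prop :=
  (exists P, [/\ is_prime_ideal P, {subset I <= P} & prime_height P h]) /\
  (forall P d, is_prime_ideal P -> {subset I <= P} -> prime_height P d ->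
     (h <= d)%N).

End Height.

Section LatticeIdeals.
Variables (k : fieldType) (n : nat).
Implicit Types (L : {pred 'rV[int]_n}) (I : {pred {mpoly k[n]}}).

Definition mnm_int (u : 'X_{1..n}) : 'rV[int]_n := \row_i (u i)%:Z.

Definition lattice_ideal L : {pred {mpoly k[n]}} :=
  ideal_gen [pred f | `[< exists u v : 'X_{1..n},
      mnm_int u - mnm_int v \in L /\ f = 'X_[u] - 'X_[v] >]].

Definition is_binomial (f : {mpoly k[n]}) : Prop :=
  exists u v : 'X_{1..n}, u != v /\ f = 'X_[u] - 'X_[v].

Definition complete_intersection I : Prop :=
  exists r, ideal_height I r /\
    exists g : r.-tuple {mpoly k[n]}, I =i ideal_gen [pred f in g].

Definition binomial_complete_intersection I : Prop :=
  exists r, ideal_height I r /\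
    exists g : r.-tuple {mpoly k[n]},
      {in g, forall f, is_binomial f} /\ I =i ideal_gen [pred f in g].

End LatticeIdeals.

Arguments lattice_ideal k {n} L.

Section Sigma.
Variables (n : nat) (L : {pred 'rV[int]_n}).

Definition lattice_sigma : {set 'I_n} :=
  [set i | `[< exists w, [/\ w \in L, forall j, 0 <= w 0 j & w 0 i != 0] >]].

(* The coordinates outside sigma are renumbered increasingly by
   0, ..., #|~: sigma| - 1, so that k[x_i : i \notin sigma] is
   {mpoly k[#|~: sigma|]}. *)
Definition restr_sigma (u : 'rV[int]_n) : 'rV[int]_#|~: lattice_sigma| :=
  \row_j u 0 (enum_val j).

Definition lattice_restr : {pred 'rV[int]_#|~: lattice_sigma|} :=
  zmod_gen [pred v | `[< exists2 u, u \in L & v = restr_sigma u >]].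

End Sigma.

Arguments restr_sigma {n} L u.
Arguments lattice_restr {n} L.

(* Main.v *)
Require Import Defs.
From HB Require Import structures.
From mathcomp Require Import all_boot all_order all_algebra.
From mathcomp Require Import boolp ring zify.
From mathcomp Require classical_sets.

(** The theorem compares the number of generators with the height, so the height
    of a lattice ideal has to be known: it is the rank of the lattice
    ([lattice_ideal_height]). Every prime [P] above [lattice_ideal k L] is the end
    of a chain of primes of length the rank of [L]: replacing [P] by the ideal
    generated by those of its elements that do not involve a well chosen variable
    [x_j] gives a smaller prime, which still contains the relations of [L] without
    [x_j] ([lattice_prime_chain]). Conversely, when the coordinates in [J] embed [L]
    into [int^J], the lattice ideal contains no nonzero polynomial in the variables
    outside [J]; a prime above it that is maximal with this property has at least
    [n - #|J|] algebraically independent elements in its quotient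
    ([lattice_ideal_prime]), and each step down a chain of primes provides one more
    ([prime_chain_leq]).

    Let [lattice_pure L] be the kernel of the projection of [L] off sigma, of rank
    [r2], and let [r1] be the rank of the projection; the heights of the two ideals
    are then [r1 + r2] and [r1] ([sigma_heights]). There is a vector of [L] that is
    positive on sigma and zero elsewhere, so the variables of sigma are invertible
    modulo the ideal of [L], and the projection of [L] contains no nonzero
    nonnegative vector.

    Suppose that [r1 + r2] binomials generate the ideal of [L]. A monomial that is
    congruent to [1] is reached from [1] by the moves given by these binomials, and
    all monomials on the way are supported on sigma; hence the exponent vectors of the
    generators supported on sigma generate [lattice_pure L], and there are at least
    [r2] such generators ([pure_on_sigma_moves]). They vanish when the variables of sigma are set to
    [1], and the images of the others, at most [r1] in number, generate the ideal of
    the projection ([lattice_restr_generators]).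

    Suppose that [r1] polynomials generate the ideal of the projection. By a graded
    version of the Nakayama lemma, at most [r1] binomials do
    ([lattice_ideal_binomial_generators]). Lifted to [L], and completed by the
    [x^g - 1] for [g] in a basis of [lattice_pure L] formed of nonnegative vectors
    ([nonneg_basis]), they generate the ideal of [L]
    ([lattice_ideal_lift_generators]).

    Membership of a binomial in an ideal generated by binomials is translated into
    connectedness of monomials under moves by the linear form [mcoefsum], which adds
    up the coefficients over a class of monomials. *)

Set Implicit Arguments.
Unset Strict Implicit.
Unset Printing Implicit Defensive.

Import GRing.Theory Order.TTheory Num.Theory.
Local Open Scope ring_scope.

(** * Ideals generated by a predicate *)

Definition ideal_closed (R : comNzRingType) (I : {pred R}) : Prop :=
  0 \in I /\ forall a, {in I &, forall u v, a * u + v \in I}.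

Section Ideals.
Variable R : comNzRingType.
Implicit Types S I : {pred R}.

Lemma ideal_closedD I : ideal_closed I -> {in I &, forall u v, u + v \in I}.
Proof. by case=> _ HI u v Iu Iv; rewrite -[u]mul1r HI. Qed.

Lemma ideal_closedM I : ideal_closed I -> forall a, {in I, forall u, a * u \in I}.
Proof. by case=> I0 HI a u Iu; rewrite -[a * u]addr0 HI. Qed.

Lemma ideal_closedB I : ideal_closed I -> {in I &, forall u v, u - v \in I}.
Proof. by case=> _ HI u v Iu Iv; rewrite addrC -mulN1r HI. Qed.

Lemma ideal_closed_sum I (T : eqType) (r : seq T) (P : pred T) (F : T -> R) :
  ideal_closed I -> (forall i, i \in r -> P i -> F i \in I) ->
  \sum_(i <- r | P i) F i \in I.
Proof.
move=> HI HF; rewrite big_seq_cond.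
elim/big_ind: _ => [|u v|i /andP[]]; [exact: HI.1|exact: ideal_closedD|exact: HF].
Qed.

Lemma prime_ideal_closed I : is_prime_ideal I -> ideal_closed I.
Proof. by case=> -[I0 _ HI] _; split. Qed.

Lemma ideal_genP S f :
  reflect (exists2 s : seq (R * R),
            {in s, forall p, p.2 \in S} & f = \sum_(p <- s) p.1 * p.2)
          (f \in ideal_gen S).
Proof. exact: asboolP. Qed.

Lemma ideal_gen_closed S : ideal_closed (ideal_gen S).
Proof.
split=> [|a u v /ideal_genP[s Hs ->] /ideal_genP[t Ht ->]].
  by apply/ideal_genP; exists [::] => [p|]; rewrite ?big_nil.
apply/ideal_genP; exists ([seq (a * p.1, p.2) | p <- s] ++ t).
  by move=> p; rewrite mem_cat => /orP[/mapP[q qs ->]|]; [exact: (Hs q qs)|exact: Ht].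
rewrite big_cat big_map mulr_sumr /=; congr (_ + _).
by apply: eq_bigr => p _; rewrite mulrA.
Qed.

Lemma sub_ideal_gen S : {subset S <= ideal_gen S}.
Proof.
move=> f Sf; apply/ideal_genP; exists [:: (1, f)]; last by rewrite big_seq1 mul1r.
by move=> p; rewrite inE => /eqP->.
Qed.

Lemma ideal_gen_min S I :
  ideal_closed I -> {subset S <= I} -> {subset ideal_gen S <= I}.
Proof.
move=> HI SI f /ideal_genP[s Hs ->].
by apply: ideal_closed_sum => // p ps _; apply: ideal_closedM => //; exact/SI/Hs.
Qed.

Lemma ideal_gen_tupleP r (g : r.-tuple R) f :
  f \in ideal_gen [pred h in g] ->
  exists a : 'I_r -> R, f = \sum_i a i * tnth g i.
Proof.
set I : {pred R} := [pred f | `[< exists a : 'I_r -> R, f = \sum_i a i * tnth g i >]].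
suff /ideal_gen_min sub : ideal_closed I.
  move=> Hf; apply/asboolP; move: f Hf; apply: sub => h /tnthP[i ->].
  apply/asboolP; exists (fun j => (j == i)%:R).
  by rewrite (bigD1 i) //= eqxx mul1r big1 ?addr0 // => j /negbTE->; rewrite mul0r.
split=> [|a u v /asboolP[b ->] /asboolP[c ->]]; apply/asboolP.
  by exists (fun=> 0); rewrite big1 // => i _; rewrite mul0r.
exists (fun i => a * b i + c i); rewrite mulr_sumr -big_split /=.
by apply: eq_bigr => i _; rewrite mulrDl mulrA.
Qed.

Lemma ideal_gen_finite S (g : seq R) : {subset g <= ideal_gen S} ->
  exists2 s : seq R, {subset s <= S} & {subset g <= ideal_gen [pred f in s]}.
Proof.
elim: g => [|f g IHg] gS; first by exists [::].
have [h hg|s sS gs] := IHg; first by rewrite gS // inE hg orbT.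
have /ideal_genP[t tS ->] := gS f (mem_head _ _).
exists ([seq p.2 | p <- t] ++ s) => [h|h].
  by rewrite mem_cat => /orP[/mapP[p pt ->]|/sS//]; apply: tS.
rewrite inE => /orP[/eqP->|/gs].
  apply/ideal_genP; exists t => // p pt; rewrite inE mem_cat.
  by apply/orP; left; apply: map_f.
apply: ideal_gen_min; [exact: ideal_gen_closed|move=> l ls; apply: sub_ideal_gen].
by move: ls; rewrite !inE mem_cat orbC => ->.
Qed.

(** The prime that realizes one of the heights bounds the other one from above. *)
Lemma ideal_height_unique I h h' : ideal_height I h -> ideal_height I h' -> h = h'.
Proof.
move=> [[P [P1 P2 P3]] Hm] [[P' [P1' P2' P3']] Hm'].
by apply/eqP; rewrite eqn_leq (Hm P') // (Hm' P).
Qed.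

End Ideals.

(** * Monomial projections and binomial ideals *)

Section Projection.
Variables (k : fieldType) (n : nat).
Implicit Types (p : pred 'X_{1..n}) (f q : {mpoly k[n]}) (u v a b : 'X_{1..n}).

Definition mproj p f : {mpoly k[n]} := \sum_(m <- msupp f | p m) f@_m *: 'X_[m].

Lemma mcoeff_mproj p f m : (mproj p f)@_m = if p m then f@_m else 0.
Proof.
rewrite /mproj raddf_sum /=; under eq_bigr do rewrite mcoeffZ mcoeffX.
have [mf|/memN_msupp_eq0 fm] := boolP (m \in msupp f); last first.
  rewrite fm if_same big1 // => i _; case: eqP => [->|]; rewrite ?mulr0 //.
  by rewrite fm mul0r.
rewrite -big_filter; case: ifPn => pm; last first.
  rewrite big_seq big1 // => i; rewrite mem_filter; case: eqP => [->|]; rewrite ?mulr0 //.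
  by rewrite (negbTE pm).
rewrite (bigD1_seq m) ?filter_uniq ?mem_filter ?pm ?msupp_uniq //=.
by rewrite eqxx mulr1 big1 ?addr0 // => i /negbTE->; rewrite mulr0.
Qed.

Lemma mproj_is_linear p : linear (mproj p).
Proof.
move=> c f g; apply/mpolyP => m; rewrite mcoeffD mcoeffZ !mcoeff_mproj.
by case: ifP => _; rewrite ?mcoeffD ?mcoeffZ // mulr0 addr0.
Qed.

HB.instance Definition _ p :=
  GRing.isLinear.Build k {mpoly k[n]} {mpoly k[n]} _ (mproj p) (mproj_is_linear p).

Lemma mprojX p u : mproj p 'X_[u] = if p u then 'X_[u] else 0.
Proof.
apply/mpolyP => m; rewrite mcoeff_mproj.
case: ifPn => pm; case: ifPn => pu; rewrite ?mcoeffX ?mcoeff0 //; case: eqP => // um.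
  by rewrite um pm in pu.
by rewrite -um pu in pm.
Qed.

(** Multiplying a binomial by a monomial gives two monomials that a
    shift-compatible predicate either keeps together or kills together. *)
Lemma mproj_binomial p q u v :
  (forall c, p (c + u)%MM = p (c + v)%MM) ->
  mproj p (q * ('X_[u] - 'X_[v])) =
  mproj (fun c => p (c + u)%MM) q * ('X_[u] - 'X_[v]).
Proof.
move=> Huv; elim/mpolyind: q => [|c m q _ _ IHq]; first by rewrite mul0r !raddf0 mul0r.
rewrite mulrDl !raddfD /= mulrDl IHq; congr (_ + _).
rewrite -scalerAl !linearZ /= -scalerAl; congr (_ *: _).
rewrite mulrBr -!mpolyXD raddfB /= !mprojX Huv.
by case: ifP => _; rewrite ?subr0 ?mul0r // mulrBr -!mpolyXD.
Qed.

Definition mcoefsum p f : k := (mproj p f).@[fun=> 1].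

Lemma mcoefsum_is_additive p : additive (mcoefsum p).
Proof. by move=> f g; rewrite /mcoefsum !raddfB. Qed.

HB.instance Definition _ p := GRing.isZmodMorphism.Build _ _ (mcoefsum p) (mcoefsum_is_additive p).

Lemma mcoefsumX p u : mcoefsum p 'X_[u] = (p u)%:R.
Proof.
rewrite /mcoefsum mprojX; case: ifP => _; last exact: meval0.
by rewrite mevalX big1 // => i _; rewrite expr1n.
Qed.

Lemma mcoefsumZ p c f : mcoefsum p (c *: f) = c * mcoefsum p f.
Proof. by rewrite /mcoefsum linearZ mevalZ. Qed.

Section BinomialIdeal.
Variables (S : {pred {mpoly k[n]}}) (p : pred 'X_{1..n}).
Hypothesis pS : {in S, forall f, exists u v,
  f = 'X_[u] - 'X_[v] /\ forall c, p (c + u)%MM = p (c + v)%MM}.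

(** Each [q * (x^u - x^v)] projects to a multiple of [x^u - x^v], and this vanishes
    at the point [(1, ..., 1)]. Applied to a class of monomials closed under the moves
    [u <-> v], this linear form shows that the ideal does not connect the class to
    its complement. *)
Lemma mcoefsum_ideal_gen f : f \in ideal_gen S -> mcoefsum p f = 0.
Proof.
case/ideal_genP => s Hs ->; rewrite raddf_sum big_seq big1 //= => -[q b] /Hs /pS.
case=> u [v [/= -> puv]]; rewrite /mcoefsum mproj_binomial // mevalM mevalB !mevalX.
by rewrite !big1 ?subrr ?mulr0 // => i _; rewrite expr1n.
Qed.

Lemma mproj_ideal_gen f : f \in ideal_gen S -> mproj p f \in ideal_gen S.
Proof.
case/ideal_genP => s Hs ->; rewrite raddf_sum /=.
apply: (ideal_closed_sum (ideal_gen_closed S)) => -[q b] /Hs /= Sb _.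
case: (pS Sb) => u [v [defb puv]]; rewrite defb mproj_binomial // -defb.
apply: (ideal_closedM (ideal_gen_closed S)); exact: sub_ideal_gen.
Qed.

End BinomialIdeal.
End Projection.

(** * Bases of lattices *)

Section Lattices.
Variable n : nat.
Implicit Types (L : {pred 'rV[int]_n}) (r : nat).

Definition int_free r (U : 'M[int]_(r, n)) : Prop :=
  forall c : 'rV_r, c *m U = 0 -> c = 0.

Lemma zmod_closed_scale L : zmod_closed L -> forall a, {in L, forall u, a *: u \in L}.
Proof.
move=> HL a u Lu; have [L0 LB] := HL; have [_ LD] := GRing.zmod_closedD HL.
have Ln (m : nat) : m%:Z *: u \in L.
  by elim: m => [|m IHm]; rewrite ?scale0r // intS scalerDl scale1r LD.
case: a => m; first exact: Ln.
by rewrite NegzE scaleNr -sub0r LB.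
Qed.

Lemma zmod_closed_mulmx L r (U : 'M_(r, n)) :
  zmod_closed L -> (forall i, row i U \in L) -> forall c : 'rV_r, c *m U \in L.
Proof.
move=> HL LU c; rewrite mulmx_sum_row.
elim/big_ind: _ => [|u v|i _]; [exact: HL.1|exact: (GRing.zmod_closedD HL).2|].
exact: zmod_closed_scale.
Qed.

Lemma lattice_kernel_closed L (P : pred 'I_n) : zmod_closed L ->
  zmod_closed [pred u | (u \in L) && [forall (j | P j), u 0 j == 0]].
Proof.
case=> L0 LB; split=> [|u v]; rewrite !inE.
  by rewrite L0; apply/forall_inP => j _; rewrite mxE.
move=> /andP[Lu /forall_inP u0] /andP[Lv /forall_inP v0]; rewrite LB //=.
by apply/forall_inP => j Pj; rewrite !mxE (eqP (u0 j Pj)) (eqP (v0 j Pj)).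
Qed.

(** The [j]-th coordinates of the elements of [L] form a subgroup of [int],
    generated by its least positive element. *)
Lemma lattice_pivot L (j : 'I_n) (u : 'rV_n) : zmod_closed L -> u \in L -> u 0 j != 0 ->
  exists2 w, w \in L & w 0 j != 0 /\ forall v, v \in L -> exists c, v 0 j = c * w 0 j.
Proof.
move=> HL Lu u0; have [L0 LB] := HL.
pose Q d := `[< exists2 v, v \in L & v 0 j = d.+1%:Z >].
have exQ : exists d, Q d.
  exists (absz (u 0 j)).-1; apply/asboolP.
  exists (Num.sg (u 0 j) *: u); first exact: zmod_closed_scale.
  by rewrite mxE prednK ?absz_gt0 // abszE -normrEsg.
have [d /asboolP[w Lw wd] dmin] := ex_minnP exQ.
exists w => //; split=> [|v Lv]; first by rewrite wd.
exists (divz (v 0 j) (w 0 j)); rewrite {1}(divz_eq (v 0 j) (w 0 j)).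
have w0 : w 0 j != 0 by rewrite wd.
have := modz_ge0 (v 0 j) w0; have := ltz_mod (v 0 j) w0.
case def_e: (modz _ _) => [[|e]|//] lt_e _; first by rewrite addr0.
suff /dmin : Q e by move: lt_e; rewrite wd; lia.
apply/asboolP; exists (v - divz (v 0 j) (w 0 j) *: w).
  by rewrite LB // zmod_closed_scale.
by rewrite !mxE -def_e {1}(divz_eq (v 0 j) (w 0 j)) addrC addKr.
Qed.

(** Hermite reduction: a vector whose pivot generates all the coordinates at [j] is
    split off, and what remains is the sublattice where that coordinate vanishes.
    The set [J] of the pivots embeds the lattice into [int^J]. *)
Lemma lattice_basis L : zmod_closed L ->
  exists r (J : {set 'I_n}) (U : 'M[int]_(r, n)),
    [/\ (#|J| <= r)%N, forall i, row i U \in L, int_free U,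
        forall u, u \in L -> exists c, u = c *m U
      & forall u, u \in L -> (forall j, j \in J -> u 0 j = 0) -> u = 0].
Proof.
pose nz L := [set j | `[< exists2 u, u \in L & u 0 j != 0 >]].
move: {2}_.+1 (ltnSn #|nz L|) => N; elim: N L => // N IHN L ltN HL.
have [nz0|[j jnz]] := set_0Vmem (nz L).
  have L0 u : u \in L -> u = 0.
    move=> Lu; apply/rowP => j; apply/eqP; rewrite mxE; apply: contraT => uj0.
    by move/setP/(_ j): nz0; rewrite !inE => /asboolP[]; exists u.
  exists 0%N, set0, 0; split=> [|[]//|c _|u /L0->|u /L0//]; rewrite ?cards0 //.
    by rewrite [c]thinmx0.
  by exists 0; rewrite mul0mx.
have /asboolP[u Lu uj] : `[< exists2 u, u \in L & u 0 j != 0 >] by rewrite inE in jnz.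
have [w Lw [wj Hw]] := lattice_pivot HL Lu uj; have [L0 LB] := HL.
have HL' := lattice_kernel_closed (pred1 j) HL.
set L' := (X in zmod_closed X) in HL'.
have inL' v : (v \in L') = (v \in L) && (v 0 j == 0).
  rewrite inE; congr (_ && _); apply/forall_inP/eqP => [/(_ j (eqxx j))/eqP//|].
  by move=> vj i /eqP->; rewrite vj.
have [|r [J [U [cJ LU freeU genU injJ]]]] := IHN L' _ HL'.
  rewrite -ltnS (leq_trans _ ltN) // ltnS proper_card //; apply/properP; split.
    apply/subsetP => i; rewrite !inE => /asboolP[v]; rewrite inL' => /andP[Lv _ vi].
    by apply/asboolP; exists v.
  exists j => //; rewrite inE; apply/asboolP => -[v]; rewrite inL' => /andP[_ /eqP->].
  by rewrite eqxx.
have U'j (c : 'rV_r) : (c *m U) 0 j = 0.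
  have := zmod_closed_mulmx HL' LU c; rewrite inL' => /andP[_ /eqP//].
exists (1 + r)%N, (j |: J), (col_mx w U); split.
- by rewrite (leq_trans (leq_card_setU _ _)) // cards1 leq_add2l.
- move=> i; case: (split_ordP i) => i' ->.
    by rewrite rowKu ord1 row_id.
  by rewrite rowKd; have := LU i'; rewrite inL' => /andP[].
- move=> c; rewrite -[c]hsubmxK mul_row_col => cU.
  have : lsubmx c 0 0 * w 0 j = 0.
    move/rowP/(_ j): cU; rewrite [LHS]mxE U'j addr0 [RHS]mxE.
    by rewrite [LHS]mxE big_ord1.
  move/eqP; rewrite mulf_eq0 (negbTE wj) orbF => /eqP c0.
  have {}c0 : lsubmx c = 0 by apply/rowP => i; rewrite ord1 c0 mxE.
  move: cU; rewrite c0 mul0mx add0r => /freeU->.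
  by rewrite row_mx0.
- move=> v Lv; have [a va] := Hw v Lv.
  have /genU[c vc] : v - a *: w \in L'.
    by rewrite inL' LB ?zmod_closed_scale // !mxE va subrr eqxx.
  exists (row_mx a%:M c); rewrite mul_row_col mul_scalar_mx -vc.
  by rewrite addrC subrK.
move=> v Lv v0; apply: injJ => [|i iJ]; last by rewrite v0 // !inE iJ orbT.
by rewrite inL' Lv v0 ?eqxx // !inE eqxx.
Qed.

End Lattices.

(** Over the rationals a tall matrix has a nonzero left kernel; clearing the
    denominators makes a kernel vector integral. *)
Lemma int_left_kernel m q (A : 'M[int]_(m, q)) :
  (q < m)%N -> exists2 c : 'rV[int]_m, c != 0 & c *m A = 0.
Proof.
move=> ltqm; pose Aq : 'M[rat]_(m, q) := map_mx intr A.
have /rowV0Pn[c /sub_kermxP cA c0] : kermx Aq != 0.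
  rewrite kermx_eq0 /row_free neq_ltn (leq_ltn_trans _ ltqm) //.
  exact: rank_leq_col.
pose D : int := \prod_j denq (c 0 j).
pose e : 'rV[int]_m := \row_j (numq (c 0 j) * \prod_(i | i != j) denq (c 0 i)).
have eE : map_mx intr e = D%:~R *: c.
  apply/rowP => j; rewrite [RHS]mxE [LHS]mxE /e mxE /D [in RHS](bigD1 j) //= !intrM mulrAC.
  congr (_ * _); rewrite mulrC -[X in _ = X * _]divq_num_den divfK //.
  by rewrite intr_eq0 denq_neq0.
have D0 : D%:~R != 0 :> rat by rewrite intr_eq0; apply/prodf_neq0 => j _; exact: denq_neq0.
exists e.
  apply: contraNneq c0 => e0; move: eE; rewrite e0 map_mx0 => /esym/eqP.
  by rewrite scalemx_eq0 (negbTE D0).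
suff : map_mx intr (e *m A) = 0 :> 'M[rat]_(1, q).
  move=> eA; apply/matrixP => i j; move/matrixP/(_ i j)/eqP: eA.
  by rewrite !mxE intr_eq0 => /eqP.
by rewrite map_mxM eE -scalemxAl cA scaler0.
Qed.

Lemma int_free_leq n r q (U : 'M[int]_(r, n)) (C : 'M_(r, q)) (D : 'M_(q, n)) :
  int_free U -> U = C *m D -> (r <= q)%N.
Proof.
move=> freeU UCD; rewrite leqNgt; apply/negP => /(@int_left_kernel r q C)[c c0 cC].
by move/eqP: c0; apply; apply: freeU; rewrite UCD mulmxA cC mul0mx.
Qed.

(** * Chains of primes below a prime containing a lattice ideal *)

Section PrimeIdeals.
Variables (R : comNzRingType) (P : {pred R}).
Hypothesis primeP : is_prime_ideal P.

Lemma prime_idealM u v : u * v \in P -> u \notin P -> v \in P.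
Proof. by move=> /primeP.2 /orP[->|]. Qed.

Lemma prime_ideal_prod (T : eqType) (r : seq T) (F : T -> R) :
  \prod_(i <- r) F i \in P -> exists2 i, i \in r & F i \in P.
Proof.
elim: r => [|x r IHr]; first by rewrite big_nil; case: primeP => -[_ /negbTE->].
rewrite big_cons => /primeP.2 /orP[Px|/IHr[i ir Pi]].
  by exists x; rewrite ?mem_head.
by exists i; rewrite // inE ir orbT.
Qed.

Lemma prime_ideal_exp u d : u ^+ d \in P -> u \in P.
Proof.
elim: d => [|d IHd]; first by rewrite expr0; case: primeP => -[_ /negbTE->].
by rewrite exprS => /primeP.2 /orP[|/IHd].
Qed.

(** The extension [P[t]] of a prime is prime: in a product of two polynomials
    outside of it, look at the lowest coefficients that are not in [P]. *)
Lemma prime_ideal_poly (f g : {poly R}) :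
  (forall i, (f * g)`_i \in P) ->
  (forall i, f`_i \in P) \/ (forall i, g`_i \in P).
Proof.
move=> fgP; have PI := prime_ideal_closed primeP.
have [[i0 fi0]|fP] := pselect (exists i, f`_i \notin P); last first.
  by left=> i; apply: contrapT => /negP fi; apply: fP; exists i.
have [[j0 gj0]|gP] := pselect (exists i, g`_i \notin P); last first.
  by right=> i; apply: contrapT => /negP gi; apply: gP; exists i.
have [i fi mini] := ex_minnP (ex_intro (fun i => f`_i \notin P) i0 fi0).
have [j gj minj] := ex_minnP (ex_intro (fun i => g`_i \notin P) j0 gj0).
suff : f`_i * g`_j \in P by move=> /prime_idealM/(_ fi); rewrite (negbTE gj).
have := fgP (i + j)%N; rewrite coefM.
have lti : (i < (i + j).+1)%N by rewrite ltnS leq_addr.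
rewrite (bigD1 (Ordinal lti)) //= addKn => fgij.
rewrite -[X in X \in P](addrK (\sum_(l < (i + j).+1 | l != Ordinal lti)
  f`_l * g`_(i + j - l))); apply: ideal_closedB => //.
apply: ideal_closed_sum => // l _; rewrite -val_eqE /= neq_ltn => /orP[ltl|ltl].
  rewrite mulrC ideal_closedM //; apply: contraT => /mini.
  by rewrite leqNgt ltl.
rewrite ideal_closedM //; apply: contraT => /minj.
by have := ltn_ord l; lia.
Qed.

End PrimeIdeals.

Section Monomials.
Variables (k : fieldType) (n : nat).
Implicit Types (u v : 'X_{1..n}) (w : 'rV[int]_n) (L : {pred 'rV[int]_n}).
Implicit Types (P I : {pred {mpoly k[n]}}) (f : {mpoly k[n]}).

Definition mpospart w : 'X_{1..n} :=
  [multinom if (0 <= w 0 i)%R then absz (w 0%R i) else 0%N | i < n].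

Lemma mpospartB w : mnm_int (mpospart w) - mnm_int (mpospart (- w)) = w.
Proof.
apply/rowP => i; rewrite !mxE !mnmE !mxE; move: (w 0 i) => z; case: ifP => Hp; case: ifP => Hn; lia.
Qed.

Lemma mnm_intD u v : mnm_int (u + v) = mnm_int u + mnm_int v.
Proof. by apply/rowP => i; rewrite !mxE mnmDE PoszD. Qed.

Lemma mnm_int0 : mnm_int 0 = 0 :> 'rV_n.
Proof. by apply/rowP => i; rewrite !mxE mnm0E. Qed.

Lemma mnm_int_sum (I : finType) (F : I -> 'X_{1..n}) (c : I -> nat) :
  mnm_int (\sum_i F i *+ c i) = \sum_i (c i)%:Z *: mnm_int (F i).
Proof.
rewrite (big_morph _ mnm_intD mnm_int0); apply: eq_bigr => i _.
by apply/rowP => j; rewrite !mxE mulmnE mulrC PoszM.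
Qed.

Lemma mnm_int_inj : injective (@mnm_int n).
Proof. by move=> u v /rowP uv; apply/mnmP => i; have := uv i; rewrite !mxE => -[]. Qed.

Lemma mnm_int_mpospart w : (forall i, 0 <= w 0 i) -> mnm_int (mpospart w) = w.
Proof. by move=> w0; apply/rowP => i; rewrite mxE mnmE w0 gez0_abs. Qed.

Definition lattice_binomial L : {pred {mpoly k[n]}} :=
  [pred f | `[< exists u v : 'X_{1..n},
     mnm_int u - mnm_int v \in L /\ f = 'X_[u] - 'X_[v] >]].

Lemma lattice_binomialD L w c u v : zmod_closed L -> mnm_int u - mnm_int v \in L ->
  (mnm_int (c + u) - w \in L) = (mnm_int (c + v) - w \in L).
Proof.
move=> HL Luv; have [L0 LB] := HL; have [_ LD] := GRing.zmod_closedD HL.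
rewrite !mnm_intD; apply/idP/idP => Lc.
  have := LB _ _ Lc Luv; congr (_ \in L); apply/rowP => i; rewrite !mxE; ring.
have := LD _ _ Lc Luv; congr (_ \in L); apply/rowP => i; rewrite !mxE; ring.
Qed.

Lemma lattice_ideal_binomial L u v :
  mnm_int u - mnm_int v \in L -> 'X_[u] - 'X_[v] \in lattice_ideal k L.
Proof. by move=> Luv; apply: sub_ideal_gen; apply/asboolP; exists u, v. Qed.

Lemma lattice_ideal_min L I : ideal_closed I ->
  (forall u v, mnm_int u - mnm_int v \in L -> 'X_[u] - 'X_[v] \in I) ->
  {subset lattice_ideal k L <= I}.
Proof.
move=> HI LI; apply: ideal_gen_min => // f /asboolP[u [v [Luv ->]]]; exact: LI.
Qed.

(** The monomials of a given degree for the grading by [int^n / L] form a class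
    that is closed under the moves of [L]. *)
Lemma lattice_ideal_mcoefsum L w f : zmod_closed L -> f \in lattice_ideal k L ->
  mcoefsum (fun a => mnm_int a - w \in L) f = 0.
Proof.
move=> HL; apply: mcoefsum_ideal_gen => _ /asboolP[a [b [Lab ->]]].
exists a, b; split=> // c; exact: lattice_binomialD.
Qed.

Lemma binomial_in_lattice_ideal L u v : zmod_closed L ->
  (('X_[u] - 'X_[v] : {mpoly k[n]}) \in lattice_ideal k L) =
  (mnm_int u - mnm_int v \in L).
Proof.
move=> HL; apply/idP/idP; last exact: lattice_ideal_binomial.
move/(lattice_ideal_mcoefsum (mnm_int v) HL)/eqP.
rewrite raddfB /= !mcoefsumX subrr HL.1 subr_eq0.
by case: (_ \in L) => //; rewrite eq_sym oner_eq0.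
Qed.

Lemma prime_idealX P u : is_prime_ideal P -> 'X_[u] \in P ->
  exists2 i, u i != 0%N & 'X_i \in P.
Proof.
move=> primeP; rewrite mpolyXE_id => /(prime_ideal_prod primeP)[i _ Pi].
exists i; last exact: prime_ideal_exp Pi.
apply: contraTneq Pi => ->; rewrite expr0; by case: primeP => -[].
Qed.

Definition mnm_drop (j : 'I_n) u : 'X_{1..n} :=
  [multinom (if i == j then 0 else u i)%N | i < n].

Definition var_split (j : 'I_n) : {mpoly k[n]} -> {poly {mpoly k[n]}} :=
  mmap (polyC \o @mpolyC n k) (fun i => if i == j then 'X else ('X_i)%:P).

Lemma var_splitD j : {morph var_split j : f g / f + g}.
Proof. exact: raddfD. Qed.

Lemma var_splitB j : {morph var_split j : f g / f - g}.
Proof. exact: raddfB. Qed.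

Lemma var_splitM j : {morph var_split j : f g / f * g}.
Proof. exact: rmorphM. Qed.

Lemma var_splitC j c : var_split j c%:MP = c%:MP%:P.
Proof. exact: mmapC. Qed.

Lemma var_splitX j u : var_split j 'X_[u] = 'X_[mnm_drop j u] *: 'X^(u j).
Proof.
rewrite /var_split mmapX /mmap1 (bigD1 j) //= eqxx [in RHS]mpolyXE_id [in RHS](bigD1 j) //=.
rewrite mnmE eqxx expr0 mul1r mulrC -mul_polyC; congr (_ * _).
rewrite rmorph_prod; apply: eq_bigr => i ij.
by rewrite (negbTE ij) mnmE (negbTE ij) rmorphXn.
Qed.

Lemma var_splitK j f : (var_split j f).['X_j] = f.
Proof.
elim/mpolyind: f => [|c m f _ _ IHf]; first by rewrite -mpolyC0 var_splitC hornerC.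
rewrite var_splitD hornerD -mul_mpolyC var_splitM hornerM var_splitC hornerC.
congr (_ * _ + _) => //; rewrite var_splitX hornerZ hornerXn mpolyXn -mpolyXD; congr 'X_[_].
apply/mnmP => i; rewrite mnmDE mulmnE mnmE mnm1E eq_sym.
by case: eqP => [->|_]; rewrite ?mul1n ?mul0n ?addn0.
Qed.

(** The largest ideal inside [P] that is generated by polynomials not involving
    [x_j]. *)
Definition var_core j P : {pred {mpoly k[n]}} :=
  [pred f | `[< forall i, (var_split j f)`_i \in P >]].

(** The core is the inverse image of the prime [P[t]] under [x_j |-> t]. *)
Lemma var_core_prime j P : is_prime_ideal P -> is_prime_ideal (var_core j P).
Proof.
move=> primeP; have PI := prime_ideal_closed primeP; split.
  split=> [||a u v /asboolP uP /asboolP vP].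
  - by apply/asboolP => i; rewrite -mpolyC0 var_splitC mpolyC0 coefC if_same PI.1.
  - apply/asboolP => /(_ 0%N); rewrite -mpolyC1 var_splitC coefC mpolyC1.
    by case: primeP => -[_ /negP].
  apply/asboolP => i; rewrite var_splitD var_splitM coefD coefM.
  apply: (ideal_closedD PI) (vP i); apply: (ideal_closed_sum PI) => l _ _.
  exact: (ideal_closedM PI).
move=> u v /asboolP; rewrite var_splitM => /(prime_ideal_poly primeP)[uP|vP].
  by apply/orP; left; apply/asboolP.
by apply/orP; right; apply/asboolP.
Qed.

Lemma var_core_sub j P : ideal_closed P -> {subset var_core j P <= P}.
Proof.
move=> HP f /asboolP fP; rewrite -(var_splitK j f) horner_coef.
by apply: ideal_closed_sum => // i _ _; rewrite mulrC ideal_closedM.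
Qed.

Lemma prime_chainS P P' r : is_prime_ideal P -> {subset P' <= P} ->
  ~ {subset P <= P'} -> prime_chain P' r -> prime_chain P r.+1.
Proof.
move=> primeP sub nsub [p [pp plt pr]].
exists (fun i => if (i <= r)%N then p i else P); split=> [i _|i|]; last by rewrite ltnn.
  by case: ifP => [/pp|].
rewrite ltnS => leir; rewrite leir.
have [ltir|] := ltnP i r; first exact: plt.
move=> leri; have -> : i = r by apply/eqP; rewrite eqn_leq leir.
split=> [f|H]; first by rewrite pr; exact: sub.
by apply: nsub => f /H; rewrite pr.
Qed.

(** The core of [P] at [j] still contains the relations of the sublattice of [L]
    where the coordinate at [j] vanishes, whose rank drops by one. It is strictly
    smaller than [P] if [j] is chosen well. Given a nonzero [w] in [L], a variable of
    its support that lies in [P] does not lie in the core. If there is none, any [j]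
    in the support will do: the binomial of [w] lies in [P], but if it lay in the
    core, one of its two terms with [x_j] erased would be a coefficient lying in [P],
    and then [P] would contain a variable in the support of [w]. *)
Lemma lattice_prime_chain r L (U : 'M_(r, n)) P :
  zmod_closed L -> (forall i, row i U \in L) -> int_free U ->
  is_prime_ideal P -> {subset lattice_ideal k L <= P} -> prime_chain P r.
Proof.
elim: r L U P => [|r IHr] L U P HL LU freeU primeP LP.
  by exists (fun=> P); split.
have PI := prime_ideal_closed primeP.
have := LU 0; move def_w: (row 0 U) => w Lw.
have w0 : w != 0.
  apply: contraPneq (freeU (delta_mx 0 0)) => w0; rewrite -rowE def_w => /(_ w0).
  by move/rowP/(_ 0)/eqP; rewrite !mxE !eqxx oner_eq0.
have [j wj coreP] : exists2 j, w 0 j != 0 & ~ {subset P <= var_core j P}.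
  have [[j wj Pj]|noP] := pselect (exists2 j, w 0 j != 0 & 'X_j \in P).
    exists j => // /(_ _ Pj) /asboolP/(_ 1%N).
    rewrite var_splitX coefZ coefXn mnm1E eqxx mulr1.
    rewrite (_ : mnm_drop _ _ = 0%MM) ?mpolyX0; first by case: primeP => -[_ /negbTE->].
    by apply/mnmP => i; rewrite mnmE mnm1E mnm0E eq_sym; case: eqP.
  have /rV0Pn[j wj] := w0; exists j => // coreP; apply: noP.
  pose f : {mpoly k[n]} := 'X_[mpospart w] - 'X_[mpospart (- w)].
  have /coreP/asboolP Pf : f \in P.
    by apply/LP/lattice_ideal_binomial; rewrite mpospartB.
  have drop0 (v : 'rV[int]_n) : (v = w \/ v = - w) -> 'X_[mnm_drop j (mpospart v)] \in P ->
      exists2 j, w 0 j != 0 & 'X_j \in P.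
    move=> vw /(prime_idealX primeP)[i i0 Pi]; exists i => //.
    move: i0; rewrite mnmE; case: (i =P j) => [->|_]; first by rewrite eqxx.
    rewrite mnmE.
    by case: vw => ->; rewrite ?mxE; apply: contraNneq => ->; rewrite ?oppr0.
  have [wj0|wj0] := boolP (0 <= w 0 j).
    have := Pf (mpospart w j); rewrite var_splitB !var_splitX coefB !coefZ !coefXn eqxx.
    rewrite (_ : (_ == mpospart (- w) j) = false) ?mulr0 ?subr0 ?mulr1.
      by apply: drop0; left.
    rewrite !mnmE wj0 !mxE; rewrite oppr_ge0.
    case: ifP => wj0'; last by rewrite absz_eq0 (negbTE wj).
    by case/eqP: wj; apply/le_anti; rewrite wj0 wj0'.
  have := Pf (mpospart (- w) j); rewrite var_splitB !var_splitX coefB !coefZ !coefXn eqxx.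
  rewrite (_ : (_ == mpospart w j) = false) ?mulr0 ?sub0r ?mulr1.
    move=> /(ideal_closedM PI (-1)); rewrite mulN1r opprK.
    by apply: drop0; right.
  rewrite !mnmE !mxE (negbTE wj0); rewrite oppr_ge0.
  have [_|wj1] := lerP (w 0 j) 0; first by rewrite absz_eq0 oppr_eq0 (negbTE wj).
  by rewrite (ltW wj1) in wj0.
apply: (prime_chainS primeP _ coreP); first exact: var_core_sub.
have HL' := lattice_kernel_closed (pred1 j) HL; have [L0 LB] := HL.
have inL' (v : 'rV[int]_n) : v \in L -> v 0 j = 0 ->
    v \in [pred u | (u \in L) && [forall (j0 | pred1 j j0), u 0 j0 == 0]].
  by move=> Lv vj; rewrite inE Lv; apply/forall_inP => i /eqP->; rewrite vj.
pose U' := \matrix_i (w 0 j *: row (lift 0 i) U - row (lift 0 i) U 0 j *: w).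
apply: (IHr _ U' _ HL') => [i|c cU'||]; last 2 first.
- exact: var_core_prime.
- apply: lattice_ideal_min; first exact/prime_ideal_closed/var_core_prime.
  move=> u v; rewrite inE => /andP[Luv /forall_inP/(_ j (eqxx j))].
  rewrite !mxE subr_eq0 => /eqP[uvj]; apply/asboolP => i.
  rewrite var_splitB !var_splitX uvj coefB !coefZ -mulrBl mulrC ideal_closedM //.
  apply/LP/lattice_ideal_binomial; congr (_ \in L): Luv.
  apply/rowP => l; rewrite !mxE !mnmE; case: eqP => [->|//].
  by rewrite uvj !subrr.
- rewrite rowK; apply: inL'; first by rewrite LB ?zmod_closed_scale // LU.
  by rewrite !mxE mulrC subrr.
pose d := \row_i (if unlift 0 i is Some i' then w 0 j * c 0 i'
                  else - \sum_i c 0 i * row (lift 0 i) U 0 j).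
have /freeU/rowP d0 : d *m U = 0.
  rewrite mulmx_sum_row big_ord_recl [d 0 _]mxE unlift_none def_w.
  rewrite -[RHS]cU' [in RHS]mulmx_sum_row scaleNr scaler_suml -sumrN -big_split /=.
  apply: eq_bigr => i _; rewrite rowK [d 0 _]mxE liftK scalerBr !scalerA addrC.
  by rewrite [c 0 i * w 0 j]mulrC.
apply/rowP => i; have := d0 (lift 0 i); rewrite !mxE liftK => /eqP.
by rewrite mulf_eq0 (negbTE wj) => /eqP.
Qed.

End Monomials.

Arguments lattice_binomial k {n} L.

(** * Algebraic independence modulo a prime and the length of chains *)

Section Adjoin.
Variables (k : fieldType) (A : comNzRingType) (h : {rmorphism k -> A}).
Variables (t : nat) (y : 'I_t -> A) (f : A).

Definition adjoin (i : 'I_t.+1) : A := oapp y f (unlift ord_max i).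

Lemma mmap_adjoin G : mmap h adjoin G = (map_poly (mmap h y) (muni G)).[f].
Proof.
elim/mpolyind: G => [|c m G _ _ IHG]; first by rewrite muni0 map_poly0 horner0 mmap0.
rewrite mmapD muniD rmorphD hornerD /=; congr (_ + _); last exact: IHG.
rewrite muniZ mmapZ mmapX.
have -> : muni 'X_[m] = ('X_[[multinom m (widen_ord (leqnSn t) i) | i < t]] : {mpoly k[t]})
    *: 'X^(m ord_max).
  by rewrite muniE msuppX big_seq1 mcoeffX eqxx scale1r.
rewrite !map_polyZ map_polyXn !hornerZ hornerXn /= mmapC mmapX.
congr (_ * _); rewrite /mmap1 big_ord_recr /= /adjoin unlift_none /=; congr (_ * _).
apply: eq_bigr => i _; rewrite mnmE.
by rewrite (_ : widen_ord _ i = lift ord_max i) ?liftK //; apply/val_inj/esym/lift_max.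
Qed.

End Adjoin.

(** Substituting the variables in [muni G] gives [G] back. *)
Lemma muni_inj (k : fieldType) t (G : {mpoly k[t.+1]}) : muni G = 0 -> G = 0.
Proof.
move=> G0; have := mmap_adjoin (@mpolyC t.+1 k)
  (fun i => 'X_(lift ord_max i)) 'X_ord_max G.
rewrite G0 map_poly0 horner0 => <-; rewrite [LHS]mpolyE; apply: eq_bigr => m _.
rewrite mul_mpolyC; congr (_ *: _); rewrite mpolyXE_id; apply: eq_bigr => i _.
by rewrite /adjoin; case: unliftP => [j|] ->.
Qed.

Section Independence.
Variables (k : fieldType) (n : nat).
Implicit Types (P Q : {pred {mpoly k[n]}}) (f : {mpoly k[n]}).

Definition alg_indep P t (y : 'I_t -> {mpoly k[n]}) : Prop :=
  forall G : {mpoly k[t]}, mmap (@mpolyC n k) y G \in P -> G = 0.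

(** A relation [G (y, f)] modulo [P], divided by the power of the last variable
    that it contains, has a constant term [G_0 (y)], which lies in [Q] because
    [f] does. *)
Lemma alg_indep_adjoin P Q t (y : 'I_t -> {mpoly k[n]}) f :
  is_prime_ideal P -> is_prime_ideal Q -> {subset P <= Q} ->
  f \in Q -> f \notin P -> alg_indep Q y -> alg_indep P (adjoin y f).
Proof.
move=> primeP primeQ PQ Qf Pf indy G; rewrite mmap_adjoin => HG.
apply: muni_inj; move: (muni G) HG => {G}.
have QI := prime_ideal_closed primeQ.
elim/poly_ind => [_|q c IHq]; first by [].
rewrite rmorphD rmorphM /= map_polyX map_polyC /= hornerMXaddC => Pqc.
have c0 : c = 0.
  apply: indy; have := PQ _ Pqc; set cc := mmap _ _ c; set g := _.[f] => Qqc.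
  have -> : cc = g * f + cc - f * g by rewrite [f * g]mulrC addrC addKr.
  by apply: (ideal_closedB QI Qqc); rewrite [f * g]mulrC (ideal_closedM QI).
move: Pqc; rewrite c0 mmap0 addr0 mulrC => /(prime_idealM primeP)/(_ Pf)/IHq->.
by rewrite mul0r polyC0 addr0.
Qed.

Definition mdeg_le d f := forall m, m \in msupp f -> (mdeg m <= d)%N.

Lemma mdeg_leM d e f g : mdeg_le d f -> mdeg_le e g -> mdeg_le (d + e) (f * g).
Proof.
move=> fd ge m /msuppM_le /allpairsP[[a b] /= [/fd ad /ge be ->]].
by rewrite mdegD leq_add.
Qed.

Lemma mdeg_le_mmap1 d t (y : 'I_t -> {mpoly k[n]}) (m : 'X_{1..t}) :
  (forall i, mdeg_le d (y i)) -> mdeg_le (mdeg m * d) (mmap1 y m).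
Proof.
move=> yd; rewrite mdegE big_distrl /mmap1 /=.
have one_le : mdeg_le 0 1.
  by move=> l; rewrite -mpolyC1 msupp1 inE => /eqP->; rewrite mdeg0.
elim/big_ind2: _ => //; first by move=> *; exact: mdeg_leM.
move=> i _; elim: (m i) => [|e IHe]; first by rewrite mul0n expr0.
by rewrite exprS mulSn; exact: mdeg_leM.
Qed.

(** The [N ^ t] monomials of exponents less than [N] in the [y i] lie in a space
    of dimension at most [(c * N) ^ n], where [c] depends only on [t] and on the
    degrees of the [y i]; for [n < t] and large [N] they are linearly dependent. *)
Lemma alg_indep_leq P t (y : 'I_t -> {mpoly k[n]}) :
  0 \in P -> alg_indep P y -> (t <= n)%N.
Proof.
move=> P0 indy; rewrite leqNgt; apply/negP => ltnt.
pose d := (\max_i msize (y i))%N.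
have yd i : mdeg_le d (y i).
  move=> m /msize_mdeg_lt /ltnW /leq_trans; apply.
  exact: (@leq_bigmax _ (fun i => msize (y i)) i).
pose c := (d * t).+1; pose N := (c ^ n).+1; pose B := (t * N * d)%N.
pose mon s M (a : {ffun 'I_s -> 'I_M}) := [multinom (a i : nat) | i < s].
(* Row [a] holds the coefficients of the monomial of exponents [a] in the [y i]. *)
pose A := \matrix_(a < #|{ffun 'I_t -> 'I_N}|, b < #|{ffun 'I_n -> 'I_B.+1}|)
  (mmap1 y (mon _ _ (enum_val a)))@_(mon _ _ (enum_val b)).
have ltBN : (#|{ffun 'I_n -> 'I_B.+1}| < #|{ffun 'I_t -> 'I_N}|)%N.
  rewrite !card_ffun !card_ord; apply: (@leq_trans (N ^ n.+1)); last first.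
    by rewrite leq_exp2l // ltnS expn_gt0.
  apply: (@leq_ltn_trans ((c * N) ^ n)).
    have [->|n0] := posnP n; first by rewrite !expn0.
    have N0 : (0 < N)%N by []; rewrite leq_exp2r // /B /c mulSn -addn1.
    by rewrite addnC leq_add // mulnAC [(d * t)%N]mulnC.
  by rewrite expnMn expnS ltn_pmul2r ?expn_gt0 // ltnS.
have [c_ /eqP c0 cA] : exists2 e : 'rV[k]_#|{ffun 'I_t -> 'I_N}|, e != 0 & e *m A = 0.
  have /rowV0Pn[e /sub_kermxP eA e0] : kermx A != 0; last by exists e.
  rewrite kermx_eq0 /row_free neq_ltn (leq_ltn_trans (rank_leq_col A) ltBN) //.
pose G := \sum_a c_ 0 a *: 'X_[mon _ _ (enum_val a)] : {mpoly k[t]}.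
have yG : mmap (@mpolyC n k) y G = \sum_a c_ 0 a *: mmap1 y (mon _ _ (enum_val a)).
  rewrite /G raddf_sum /=; apply: eq_bigr => a _.
  by rewrite mmapZ mmapX mul_mpolyC.
have mon_inj s M : injective (@mon s M).
  move=> a b /mnmP ab; apply/ffunP => i; apply/val_inj.
  by have := ab i; rewrite !mnmE.
suff yG0 : mmap (@mpolyC n k) y G = 0.
  apply: c0; apply/rowP => a; rewrite [RHS]mxE; have := indy G; rewrite yG0 => /(_ P0) G0.
  have := congr1 (mcoeff (mon _ _ (enum_val a))) G0.
  rewrite mcoeff0 => <-; rewrite /G raddf_sum (bigD1 a) //=.
  rewrite mcoeffZ mcoeffX eqxx mulr1 big1 ?addr0 // => b ba.
  rewrite mcoeffZ mcoeffX (inj_eq (@mon_inj _ _)) (inj_eq enum_val_inj).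
  by rewrite (negbTE ba) mulr0.
rewrite yG; apply/mpolyP => m; rewrite mcoeff0 raddf_sum /=.
have [mB|] := boolP [forall i, m i < B.+1]%N.
  pose b : {ffun 'I_n -> 'I_B.+1} := [ffun i => inord (m i)].
  have <- : mon _ _ b = m.
    by apply/mnmP => i; rewrite mnmE ffunE inordK //; apply: (forallP mB).
  have := congr1 (fun v : 'rV_ _ => v 0 (enum_rank b)) cA; rewrite !mxE => {2}<-.
  by apply: eq_bigr => a _; rewrite mcoeffZ mxE enum_rankK.
rewrite negb_forall => /existsP[i]; rewrite -leqNgt => ltBm.
rewrite big1 // => a _; rewrite mcoeffZ [X in _ * X]memN_msupp_eq0 ?mulr0 //.
apply/negP => /(mdeg_le_mmap1 yd); apply/negP; rewrite -ltnNge.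
apply: leq_trans (leq_trans ltBm _); last by rewrite mdegE (bigD1 i) //= leq_addr.
rewrite ltnS /B leq_mul2r; apply/orP; right; rewrite mdegE.
rewrite -[X in (_ <= X * _)%N]card_ord -sum_nat_const; apply: leq_sum => l _.
by rewrite mnmE ltnW.
Qed.

(** An element of [p (i + 1)] outside [p i] can be adjoined to a family that is
    independent modulo [p (i + 1)], so a chain of length [d] below [P] gives [d + t]
    independent elements modulo its first prime. *)
Lemma prime_chain_leq P d t (y : 'I_t -> {mpoly k[n]}) :
  prime_chain P d -> alg_indep P y -> (d + t <= n)%N.
Proof.
move=> [p [pp plt pd]] indy.
have chain e : (e <= d)%N -> exists z : 'I_(e + t) -> {mpoly k[n]}, alg_indep (p (d - e)%N) z.
  elim: e => [_|e IHe lte]; first by exists y => G; rewrite subn0 pd; exact: indy.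
  have [z indz] := IHe (ltnW lte).
  have [sub nsub] := plt (d - e.+1)%N ltac:(lia).
  have [f Qf Pf] : exists2 f, f \in p (d - e)%N & f \notin p (d - e.+1)%N.
    apply: contrapT => nof; apply: nsub => f; rewrite -subSn // subSS => Qf.
    by apply: contraT => Pf; case: nof; exists f.
  exists (adjoin z f); apply: (alg_indep_adjoin (Q := p (d - e)%N)) => //.
  - by apply: pp; lia.
  - by apply: pp; lia.
  - by move: sub; rewrite -subSn // subSS.
have [z indz] := chain d (leqnn d); apply: (alg_indep_leq _ indz).
by rewrite subnn; have [[[]]] := pp 0%N isT.
Qed.

End Independence.

(** * The height of a lattice ideal *)

(** An ideal that is maximal among those avoiding a multiplicative set is prime. *)
Lemma prime_avoiding (R : comNzRingType) (I : {pred R}) (S : R -> Prop) :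
  ideal_closed I -> S 1 -> (forall u v, S u -> S v -> S (u * v)) ->
  (forall f, f \in I -> ~ S f) ->
  exists P, [/\ is_prime_ideal P, {subset I <= P} & forall f, f \in P -> ~ S f].
Proof.
move=> HI S1 SM IS.
pose good (A : R -> Prop) := [/\ forall f, f \in I -> A f,
  forall a u v, A u -> A v -> A (a * u + v) & forall f, A f -> ~ S f].
(* The empty set is admitted because it is the union of the empty chain. *)
pose adm (A : R -> Prop) := (forall f, ~ A f) \/ good A.
have [|A [admA maxA]] := @classical_sets.Zorn_bigcup R adm.
  move=> F Fadm Ftot.
  have [[A [FA [f Af]]]|F0] := pselect (exists A, F A /\ exists f, A f); last first.
    by left=> f [A FA Af]; apply: F0; exists A; split; last exists f.
  have goodF B g : F B -> B g -> good B.
    by move=> FB Bg; case: (Fadm B FB) => [/(_ g)|].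
  right; split=> [g Ig|a u v [B FB Bu] [C FC Cv]|g [B FB Bg]].
  - by exists A => //; have [+ _ _] := goodF _ _ FA Af; apply.
  - have [BC|CB] := Ftot _ _ FB FC.
      by exists C => //; have [_ + _] := goodF _ _ FC Cv; apply=> //; apply: BC.
    by exists B => //; have [_ + _] := goodF _ _ FB Bu; apply=> //; apply: CB.
  by have [_ _ +] := goodF _ _ FB Bg; apply.
have extA B : good B -> (forall f, A f -> B f) -> forall f, B f -> A f.
  move=> goodB AB f Bf; apply: contrapT => Af; apply: (maxA B); last by right.
  by split=> // BA; apply: Af; apply: BA.
have [I0 Ilin] := HI.
have [IA Alin AS] : good A.
  case: admA => // A0; case: (A0 0); apply: (extA (fun f => f \in I)).
  - by split=> // a u v; exact: Ilin.
  - by move=> f Af; case: (A0 f Af).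
  - exact: I0.
have A0 : A 0 by exact: IA.
have addP u : ~ A u -> exists a p, A p /\ S (a * u + p).
  move=> Au; apply: contrapT => noS; apply: Au.
  apply: (extA (fun f => exists a p, A p /\ f = a * u + p)).
  - split=> [f If|b _ _ [a [p [Ap ->]]] [c [q [Aq ->]]]|_ [a [p [Ap ->]]] Sf].
    + by exists 0, f; rewrite mul0r add0r; split=> //; exact: IA.
    + exists (b * a + c), (b * p + q); split; first exact: Alin.
      by rewrite mulrDr mulrDl addrACA mulrA.
    + by apply: noS; exists a, p.
  - by move=> f Af; exists 0, f; rewrite mul0r add0r.
  - by exists 1, 0; rewrite mul1r addr0.
exists (fun f => `[< A f >]); split=> [|f If|f /asboolP]; last exact: AS.
  split; first split=> [||a u v /asboolP Au /asboolP Av].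
  - exact/asboolP.
  - by apply/asboolP => /AS.
  - by apply/asboolP; exact: Alin.
  move=> u v /asboolP Auv; apply: contrapT => /negP; rewrite negb_or.
  move=> /andP[/asboolP/addP[a [p [Ap Su]]] /asboolP/addP[b [q [Aq Sv]]]].
  apply: (AS _ _ (SM _ _ Su Sv)).
  have -> : (a * u + p) * (b * v + q) =
      (a * b) * (u * v) + ((b * v + q) * p + ((a * u) * q + 0)) by ring.
  by do 3 apply: (Alin) => //.
by apply/asboolP; exact: IA.
Qed.

Section Height.
Variables (k : fieldType) (n : nat).
Implicit Types (L : {pred 'rV[int]_n}) (J : {set 'I_n}).

Definition mnm_map t (e : 'I_t -> 'I_n) (m : 'X_{1..t}) : 'X_{1..n} :=
  (\sum_j U_(e j) *+ m j)%MM.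

Lemma mmap1_mnm_map t (e : 'I_t -> 'I_n) m :
  mmap1 (fun j => 'X_(e j)) m = 'X_[mnm_map e m] :> {mpoly k[n]}.
Proof.
rewrite /mmap1 /mnm_map -mprodXE; apply: eq_bigr => j _; exact: mpolyXn.
Qed.

Lemma mnm_mapE t (e : 'I_t -> 'I_n) m j : injective e -> mnm_map e m (e j) = m j.
Proof.
move=> inje; rewrite mnm_sumE (bigD1 j) //= mulmnE mnm1E eqxx mul1n.
rewrite big1 ?addn0 // => i ij.
by rewrite mulmnE mnm1E (inj_eq inje) (negbTE ij).
Qed.

Lemma mnm_mapD t (e : 'I_t -> 'I_n) (a b : 'X_{1..t}) :
  mnm_map e (a + b) = (mnm_map e a + mnm_map e b)%MM.
Proof.
apply/mnmP => i; rewrite mnmDE !mnm_sumE -big_split; apply: eq_bigr => j _.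
by rewrite !mulmnE mnmDE mulnDr.
Qed.

Lemma mnm_map0 t (e : 'I_t -> 'I_n) m i : (forall j, e j != i) -> mnm_map e m i = 0%N.
Proof.
move=> ei; rewrite mnm_sumE big1 // => j _.
by rewrite mulmnE mnm1E (negbTE (ei j)).
Qed.

(** When no element of [L] but zero vanishes on [J], distinct monomials in the
    variables outside [J] have distinct degrees in [int^n / L], so [lattice_ideal]
    contains no nonzero polynomial in these variables: it avoids a multiplicative
    set. *)
Lemma lattice_ideal_prime L J : zmod_closed L ->
  (forall u, u \in L -> (forall j, j \in J -> u 0 j = 0) -> u = 0) ->
  exists P : {pred {mpoly k[n]}}, [/\ is_prime_ideal P, {subset lattice_ideal k L <= P}
    & alg_indep P (fun j : 'I_#|~: J| => 'X_(enum_val j))].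
Proof.
move=> HL injJ; pose e := @enum_val _ (mem (~: J)); pose y j : {mpoly k[n]} := 'X_(e j).
pose S f := exists2 G, G != 0 & f = mmap (@mpolyC n k) y G.
have [|||f If [G G0 fG]|P [primeP IP PS]] := @prime_avoiding _ (lattice_ideal k L) S.
- exact: ideal_gen_closed.
- by exists 1; rewrite ?oner_eq0 // -mpolyC1 mmapC.
- by move=> _ _ [G G0 ->] [H H0 ->]; exists (G * H); rewrite ?mulf_neq0 // rmorphM.
- pose m := mlead G; pose p a := mnm_int a - mnm_int (mnm_map e m) \in L.
  have := lattice_ideal_mcoefsum (mnm_int (mnm_map e m)) HL If; rewrite -/p fG /mmap.
  rewrite raddf_sum (bigD1_seq m) ?msupp_uniq ?mlead_supp //= big1 => [|m' mm'].
    rewrite addr0 mul_mpolyC mcoefsumZ mmap1_mnm_map mcoefsumX /p subrr HL.1.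
    by rewrite mulr1; apply/eqP; rewrite mleadc_eq0.
  rewrite mul_mpolyC mcoefsumZ mmap1_mnm_map mcoefsumX.
  suff -> : p (mnm_map e m') = false by rewrite mulr0.
  apply/negP => /injJ H; case/eqP: mm'; apply/mnmP => j.
  have /rowP/(_ (enum_val j)) : mnm_int (mnm_map e m') - mnm_int (mnm_map e m) = 0.
    apply: H => i iJ; rewrite !mxE !mnm_map0 // => l;
    by apply: contraTneq iJ => <-; have := enum_valP l; rewrite inE.
  by rewrite !mxE !(mnm_mapE _ _ enum_val_inj) => /eqP; rewrite subr_eq0 => /eqP[].
exists P; split=> // G PG; apply/eqP; apply: contraT => G0.
by case: (PS _ PG); exists G.
Qed.

(** The height of every prime above the ideal is at least [r] because of
    [lattice_prime_chain]; modulo the prime of [lattice_ideal_prime] there are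
    [n - #|J|] independent variables, so the chains below that prime have length at
    most [#|J|]. *)
Theorem lattice_ideal_height L J r (U : 'M[int]_(r, n)) : zmod_closed L ->
  (forall i, row i U \in L) -> int_free U -> (#|J| <= r)%N ->
  (forall u, u \in L -> (forall j, j \in J -> u 0 j = 0) -> u = 0) ->
  ideal_height (lattice_ideal k L) r.
Proof.
move=> HL LU freeU leJ injJ; split; last first.
  by move=> P d primeP LP [_ maxd]; apply/maxd/(lattice_prime_chain HL LU).
have [P [primeP LP indP]] := lattice_ideal_prime HL injJ.
exists P; split=> //; split; first exact: (lattice_prime_chain HL LU).
move=> d /prime_chain_leq/(_ indP); have := cardsC J; rewrite card_ord; lia.
Qed.

End Height.

(** * Binomial generators of complete intersections *)

Section Nakayama.
Variables (k : fieldType) (n : nat).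
Implicit Types (L : {pred 'rV[int]_n}) (J : {pred {mpoly k[n]}}).

Lemma mproj_lattice_ideal_gen L (S : {pred {mpoly k[n]}}) w f :
  zmod_closed L -> {subset S <= lattice_binomial k L} -> f \in ideal_gen S ->
  mproj (fun a => mnm_int a - w \in L) f \in ideal_gen S.
Proof.
move=> HL SL; apply: mproj_ideal_gen => _ /SL/asboolP[u [v [Luv ->]]].
exists u, v; split=> // c; exact: lattice_binomialD.
Qed.

(** The rows of [a] that form a basis modulo the maximal ideal at the origin express
    the other rows up to an error [Z] with entries in this ideal. So [g] is [q *m Z *m g]
    plus a combination of the corresponding entries of [b], and multiplying by the
    adjugate of [1 - q *m Z] leaves the single denominator [\det (1 - q *m Z)]. *)
Lemma nakayama_generators N r (b : 'cV[{mpoly k[n]}]_N) (g : 'cV_r) a q :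
  b = a *m g -> g = q *m b ->
  exists2 s : seq 'I_N, (size s <= r)%N &
  exists2 d : {mpoly k[n]}, d@_0%MM = 1 &
    forall i, d * g i 0 \in ideal_gen [pred f in [seq b j 0 | j <- s]].
Proof.
move=> ba gq; pose C := map_mx (mcoeff 0%MM) a.
pose f := maxrankfun C; pose s := [seq f i | i : 'I_(\rank C)].
have /submxP[E CE] : (C <= rowsub f C)%MS by rewrite eq_maxrowsub.
pose E' : 'M[{mpoly k[n]}]_(N, _) := map_mx (@mpolyC n k) E.
pose Z := a - E' *m rowsub f a.
have Z0 : map_mx (mcoeff 0%MM) Z = 0.
  rewrite /Z map_mxB map_mxM -/C map_mxsub -/C -map_mx_comp.
  rewrite (_ : map_mx _ E = E) -?CE ?subrr //.
  by apply/matrixP => i j; rewrite mxE /= mpolyCK.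
pose b' := rowsub f b; pose X := q *m E'; pose A := 1%:M - q *m Z.
have gE : A *m g = X *m b'.
  rewrite /A mulmxBl mul1mx -mulmxA /Z mulmxBl -ba mulmxBr -gq opprB addrC subrK.
  by rewrite -!mulmxA /b' ba -mul_rowsub_mx.
exists s; first by rewrite size_map -cardE card_ord rank_leq_col.
exists (\det A).
  rewrite -[LHS]det_map_mx /A map_mxB map_mxM Z0 mulmx0 subr0 map_mx1 det1.
  by [].
move=> i; have -> : \det A * g i 0 = (\adj A *m X *m b') i 0.
  by rewrite -mulmxA -gE mulmxA mul_adj_mx mul_scalar_mx mxE.
rewrite mxE; apply: (ideal_closed_sum (ideal_gen_closed _)) => j _ _.
apply: (ideal_closedM (ideal_gen_closed _)); apply: sub_ideal_gen.
rewrite mxE inE; apply/mapP; exists (f j) => //; apply: map_f.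
by rewrite mem_enum.
Qed.

(** Since [L] contains no nonzero nonnegative vector, the grading by [int^n / L] has
    only the constants in the degree of [1]. So the component of that degree of the
    denominator [d] given by [nakayama_generators] is [1], and a binomial [h] of the
    lattice ideal, which is homogeneous, is a component of [d * h]. *)
Lemma lattice_ideal_binomial_generators L r (g : r.-tuple {mpoly k[n]}) :
  zmod_closed L -> (forall w, w \in L -> (forall i, 0 <= w 0 i) -> w = 0) ->
  lattice_ideal k L =i ideal_gen [pred f in g] ->
  exists s : seq {mpoly k[n]}, [/\ (size s <= r)%N, {subset s <= lattice_binomial k L}
    & lattice_ideal k L =i ideal_gen [pred f in s]].
Proof.
move=> HL posL Lg.
have [|B BL gB] := @ideal_gen_finite _ (lattice_binomial k L) g.
  by move=> f fg; rewrite [_ \in _]Lg; apply: sub_ideal_gen.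
pose b := \col_(j < size B) B`_j.
have bL j : b j 0 \in lattice_binomial k L by rewrite mxE BL // mem_nth.
have [a ba] : exists a, b = a *m \col_i tnth g i.
  have /choice[a aP] : forall j, exists aj : 'I_r -> _, b j 0 = \sum_i aj i * tnth g i.
    by move=> j; apply: ideal_gen_tupleP; rewrite -Lg; apply: sub_ideal_gen.
  exists (\matrix_(j, i) a j i); apply/colP => j; rewrite aP mxE.
  by apply: eq_bigr => i _; rewrite !mxE.
have [q gq] : exists q, \col_i tnth g i = q *m b.
  have /choice[q qP] : forall i, exists qi : 'I_(size B) -> _, tnth g i = \sum_j qi j * b j 0.
    move=> i; have /gB/(@ideal_gen_tupleP _ _ (in_tuple B))[c ->] := mem_tnth i g.
    exists c; apply: eq_bigr => j _; rewrite mxE (tnth_nth 0) //.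
  exists (\matrix_(i, j) q i j); apply/colP => i; rewrite mxE qP mxE.
  by apply: eq_bigr => j _; rewrite mxE.
have [s sr [d d0 dg]] := nakayama_generators ba gq.
pose t := [seq b j 0 | j <- s].
have tL : {subset t <= lattice_binomial k L} by move=> _ /mapP[j _ ->].
exists t; split=> // [|f]; first by rewrite size_map.
apply/idP/idP; last first.
  by apply: ideal_gen_min f => [|f /tL]; [exact: ideal_gen_closed|exact: sub_ideal_gen].
apply: lattice_ideal_min f; first exact: ideal_gen_closed.
move=> u v Luv; pose h : {mpoly k[n]} := 'X_[u] - 'X_[v].
have dh : d * h \in ideal_gen [pred f in t].
  have : h \in ideal_gen [pred f in g] by rewrite -Lg lattice_ideal_binomial.
  move=> /ideal_gen_tupleP[c ->]; rewrite mulr_sumr.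
  apply: (ideal_closed_sum (ideal_gen_closed _)) => i _ _; rewrite mulrCA.
  apply: (ideal_closedM (ideal_gen_closed _)).
  by have := dg i; rewrite mxE.
suff hE : mproj (fun c => mnm_int c - mnm_int u \in L) (d * h) = h.
  by rewrite -[_ - _]/h -hE; exact: mproj_lattice_ideal_gen dh.
rewrite mproj_binomial => [|c]; last exact: lattice_binomialD.
suff -> : mproj (fun c => mnm_int (c + u) - mnm_int u \in L) d = 1 by rewrite mul1r.
apply/mpolyP => m; rewrite mcoeff_mproj mcoeff1 mnm_intD addrK.
have [->|m0] := eqVneq m 0%MM.
  by rewrite d0 mnm_int0 HL.1.
case: ifP => // /posL H; case/eqP: m0; apply: mnm_int_inj; rewrite mnm_int0 H // => i.
by rewrite mxE.
Qed.

End Nakayama.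

(** * The lattice [L], its projection off sigma and its sublattice on sigma *)

Section Sigma.
Variables (n : nat) (L : {pred 'rV[int]_n}).
Hypothesis HL : zmod_closed L.

Local Notation sigma := (lattice_sigma L).
Local Notation m := #|~: sigma|.
Local Notation restr := (restr_sigma L).
Local Notation e := (@enum_val _ (mem (~: sigma))).

(** The kernel of the projection of [L] off sigma. *)
Definition lattice_pure : {pred 'rV[int]_n} :=
  [pred u | (u \in L) && [forall (j | j \notin sigma), u 0 j == 0]].

Lemma lattice_pureP u :
  reflect (u \in L /\ forall j, j \notin sigma -> u 0 j = 0) (u \in lattice_pure).
Proof.
rewrite inE; apply: (iffP andP) => -[Lu u0]; split=> //.
  by move=> j js; apply/eqP; apply: (forall_inP u0).
by apply/forall_inP => j /u0/eqP.
Qed.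

Lemma lattice_pure_closed : zmod_closed lattice_pure.
Proof. exact: lattice_kernel_closed. Qed.

Lemma notin_sigmaP i : reflect (exists j, i = e j) (i \notin sigma).
Proof.
apply: (iffP idP) => [iS|[j ->]]; last by have := enum_valP j; rewrite inE.
by have iS' : i \in ~: sigma by [rewrite inE]; exists (enum_rank_in iS' i); rewrite enum_rankK_in.
Qed.

Lemma restr_sigmaE u j : restr u 0 j = u 0 (e j).
Proof. by rewrite mxE. Qed.

Lemma lattice_restrP v :
  reflect (exists2 u, u \in L & v = restr u) (v \in lattice_restr L).
Proof.
apply: (iffP idP) => [/asboolP[s sL ->]|[u Lu ->]]; last first.
  apply/asboolP; exists [:: (1, restr u)]; last by rewrite big_seq1 mulr1z.
  by move=> p; rewrite inE => /eqP->; apply/asboolP; exists u.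
elim: s sL => [|[c v'] s IHs] sL.
  rewrite big_nil; exists 0; first exact: HL.1.
  by apply/rowP => j; rewrite !mxE.
have [|u Lu su] := IHs; first by move=> p ps; apply: sL; rewrite inE ps orbT.
have /asboolP[u' Lu' /= ->] := sL (c, v') (mem_head _ _).
rewrite big_cons su; exists (c *: u' + u).
  by apply: (GRing.zmod_closedD HL).2 => //; apply: zmod_closed_scale.
rewrite /= -scaler_int intz; apply/rowP => j; rewrite !mxE //.
Qed.

Lemma lattice_restr_closed : zmod_closed (lattice_restr L).
Proof.
split=> [|_ _ /lattice_restrP[u Lu ->] /lattice_restrP[v Lv ->]]; apply/lattice_restrP.
  by exists 0; [exact: HL.1|apply/rowP => j; rewrite !mxE].
by exists (u - v); [exact: HL.2|apply/rowP => j; rewrite !mxE].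
Qed.

Lemma nonneg_notin_sigma u : u \in L -> (forall i, 0 <= u 0 i) ->
  forall i, i \notin sigma -> u 0 i = 0.
Proof.
move=> Lu u0 i; apply: contraNeq => ui; rewrite inE; apply/asboolP.
by exists u.
Qed.

Lemma positive_on_sigma : exists2 w, w \in L &
  (forall i, i \in sigma -> 0 < w 0 i) /\ (forall i, i \notin sigma -> w 0 i = 0).
Proof.
have /choice[w wP] : forall i, exists w, [/\ w \in L, forall j, 0 <= w 0 j
    & i \in sigma -> w 0 i != 0].
  move=> i; case: (boolP (i \in sigma)) => [|iS].
    by rewrite inE => /asboolP[w [Lw w0 wi]]; exists w.
  by exists 0; split=> //; [exact: HL.1|move=> j; rewrite mxE].
have Lw : \sum_i w i \in L.
  elim/big_ind: _ => [|u v|i _]; [exact: HL.1|exact: (GRing.zmod_closedD HL).2|].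
  by case: (wP i).
have w0 i j : 0 <= w i 0 j by case: (wP i).
exists (\sum_i w i) => //; split=> i iS; last first.
  by apply: (nonneg_notin_sigma Lw) => // j; rewrite summxE sumr_ge0.
rewrite summxE (bigD1 i) //= ltr_pwDl ?sumr_ge0 //.
by rewrite lt0r w0 andbT; case: (wP i) => _ _; apply.
Qed.

Lemma nonneg_shift (u w : 'rV[int]_n) : (forall i, i \in sigma -> 0 < w 0 i) ->
  (forall i, i \notin sigma -> 0 <= u 0 i) -> (forall i, i \notin sigma -> w 0 i = 0) ->
  exists N : nat, forall i, 0 <= (u + N%:Z *: w) 0 i.
Proof.
move=> w1 u0 w0; exists (\sum_i `|u 0%R i|)%N => i; rewrite !mxE.
have [iS|iS] := boolP (i \in sigma); last by rewrite w0 // mulr0 addr0 u0.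
have := w1 i iS; rewrite (bigD1 i) //= PoszD.
move: (_ 0 i) (u 0 i) (\sum_(_ < _ | _) _)%N => x y z; nia.
Qed.

(** A nonnegative projection is the projection of a nonnegative vector of [L], by
    adding a large multiple of a vector that is positive on sigma; and the support
    of such a vector is contained in sigma. *)
Lemma lattice_restr_pointed v : v \in lattice_restr L -> (forall j, 0 <= v 0 j) -> v = 0.
Proof.
move=> /lattice_restrP[u Lu ->] u0; have [w Lw [w1 w0]] := positive_on_sigma.
have [|N uN] := @nonneg_shift u w w1 _ w0.
  by move=> i /notin_sigmaP[j ->]; have := u0 j; rewrite restr_sigmaE.
have LuN : u + N%:Z *: w \in L.
  by apply: (GRing.zmod_closedD HL).2 => //; apply: zmod_closed_scale.
apply/rowP => j; rewrite restr_sigmaE mxE.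
have eS : e j \notin sigma by apply/notin_sigmaP; exists j.
by have := nonneg_notin_sigma LuN uN eS; rewrite !mxE w0 // mulr0 addr0.
Qed.

(** A basis of the sublattice on sigma can be chosen inside the positive orthant:
    by a unimodular change of basis a positive vector becomes a multiple of the
    first basis vector, which can then be added to the other ones. *)
Lemma nonneg_basis r (U : 'M[int]_(r, n)) : (forall i, row i U \in lattice_pure) ->
  (forall u, u \in lattice_pure -> exists c, u = c *m U) ->
  exists G : 'M[int]_(r, n), [/\ forall i, row i G \in L, forall i j, 0 <= G i j
    & forall u, u \in lattice_pure -> exists c, u = c *m G].
Proof.
case: r U => [|r] U LU genU; first by exists U; split=> // -[].
have [w Lw [w1 w0]] := positive_on_sigma.
have [c wc] : exists c, w = c *m U by apply: genU; apply/lattice_pureP.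
have [A _ [R unitR [d _ cE]]] := int_Smith_normal_form c.
pose V := R *m U; pose q := A 0 0 * d`_0.
have wq : w = q *: row 0 V.
  apply/rowP => l; rewrite wc cE -mulmxA -/V -mulmxA mxE big_ord1 [RHS]mxE [row _ _ _ _]mxE -mulrA.
  congr (_ * _); rewrite [LHS]mxE big_ord_recl [_ 0 ord0]mxE big1 ?addr0 // => i _.
  by rewrite mxE mulr0n mul0r.
have LV l : row l V \in lattice_pure.
  by rewrite row_mul zmod_closed_mulmx //; exact: lattice_pure_closed.
have genV u : u \in lattice_pure -> exists c', u = c' *m V.
  by move=> /genU[f ->]; exists (f *m invmx R); rewrite /V mulmxA mulmxKV.
clearbody V q; have V0 i l : l \notin sigma -> V i l = 0.
  by move=> lS; have /lattice_pureP[_ /(_ l lS)] := LV i; rewrite mxE.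
(* [eps * q] is nonnegative, so the sign [eps] makes the first basis vector
   nonnegative. *)
pose eps : int := if 0 <= q then 1 else -1; pose b := eps *: row 0 V.
have b1 i : i \in sigma -> 0 < b 0 i.
  move/w1; rewrite wq /b /eps !mxE; case: ifP => q0.
    rewrite mul1r; have := q0; rewrite le_eqVlt => /orP[/eqP<-|/pmulr_rgt0->//].
    by rewrite mul0r ltxx.
  by rewrite mulN1r oppr_gt0 nmulr_rgt0 // ltNge q0.
have b0 i : i \notin sigma -> b 0 i = 0 by move=> iS; rewrite !mxE V0 ?mulr0.
have bge0 i : 0 <= b 0 i.
  by have [/b1/ltW//|/b0->] := boolP (i \in sigma).
have /choice[N NP] : forall i : 'I_r.+1, exists N : nat,
    (forall l, 0 <= (row i V + N%:Z *: b) 0 l) /\ (i = 0 -> row i V + N%:Z *: b = b).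
  move=> i; have [->|i0] := eqVneq i 0.
    have [N NE] : exists N : nat, row 0 V + N%:Z *: b = b.
      rewrite /b /eps; case: ifP => _.
        by exists 0%N; rewrite scale0r addr0 scale1r.
      exists 2%N; rewrite scaleN1r scalerN.
      by apply/rowP => l; rewrite !mxE; ring.
    by exists N; rewrite NE.
  have [|N NP] := @nonneg_shift (row i V) b b1 _ b0.
    by move=> l lS; rewrite mxE V0.
  by exists N; split=> // i0'; rewrite i0' eqxx in i0.
exists (\matrix_i (row i V + (N i)%:Z *: b)); split=> [i|i j|u Lu].
- have /lattice_pureP[] : row i V + (N i)%:Z *: b \in lattice_pure; last by rewrite rowK.
  apply: (GRing.zmod_closedD lattice_pure_closed).2 => //.
  by do 2 apply: (zmod_closed_scale lattice_pure_closed).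
- by have [/(_ j)] := NP i; rewrite [X in _ -> _ -> 0 <= X]mxE.
have [c' uc] := genV u Lu; exists (c' - (\sum_i c' 0 i * (N i)%:Z) *: delta_mx 0 0).
rewrite mulmxBl -scalemxAl -rowE rowK (NP 0).2 // [in RHS]mulmx_sum_row uc mulmx_sum_row.
rewrite scaler_suml -sumrB; apply: eq_bigr => i _.
by rewrite rowK scalerDr scalerA addrK.
Qed.

End Sigma.

(** * Monomials on and off sigma *)

Section SigmaMonomials.
Variables (n : nat) (L : {pred 'rV[int]_n}).
Hypothesis HL : zmod_closed L.
Implicit Types (u v : 'X_{1..n}) (a b : 'X_{1..#|~: lattice_sigma L|}).

Local Notation sigma := (lattice_sigma L).
Local Notation m := #|~: sigma|.
Local Notation e := (@enum_val _ (mem (~: sigma))).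

Definition mnm_off u : 'X_{1..m} := [multinom u (e j) | j < m].
Definition mnm_on u : 'X_{1..n} := [multinom (if i \in sigma then u i else 0)%N | i < n].

Lemma mnm_int_off u : mnm_int (mnm_off u) = restr_sigma L (mnm_int u).
Proof. by apply/rowP => j; rewrite !mxE mnmE. Qed.

Lemma mnm_offD u v : mnm_off (u + v) = (mnm_off u + mnm_off v)%MM.
Proof. by apply/mnmP => j; rewrite mnmDE !mnmE. Qed.

Lemma mnm_off_map a : mnm_off (mnm_map e a) = a.
Proof. by apply/mnmP => j; rewrite mnmE mnm_mapE //; exact: enum_val_inj. Qed.

Lemma mnm_off_on u : mnm_off (mnm_on u) = 0%MM.
Proof.
apply/mnmP => j; rewrite !mnmE ifN //; by apply/notin_sigmaP; exists j.
Qed.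

Lemma mnm_off_eq0 u : (mnm_off u = 0%MM) <-> (forall i, i \notin sigma -> u i = 0%N).
Proof.
split=> [/mnmP u0 i /notin_sigmaP[j ->]|u0].
  by have := u0 j; rewrite !mnmE.
apply/mnmP => j; rewrite !mnmE u0 //; by apply/notin_sigmaP; exists j.
Qed.

Lemma mnm_map_sigma a i : i \in sigma -> mnm_map e a i = 0%N.
Proof.
move=> iS; apply: mnm_map0 => j; apply: contraTneq iS => <-.
by apply/notin_sigmaP; exists j.
Qed.

Lemma mnm_off_onK u : (mnm_map e (mnm_off u) + mnm_on u)%MM = u.
Proof.
apply/mnmP => i; rewrite mnmDE [mnm_on u i]mnmE.
case: (boolP (i \in sigma)) => [iS|/notin_sigmaP[j ->]]; first by rewrite mnm_map_sigma.
by rewrite addn0 mnm_mapE ?mnmE //; exact: enum_val_inj.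
Qed.

(** On sigma the exponents are free: they are taken to be the positive and negative
    parts of [w]. *)
Lemma mnm_off_lift a b w : mnm_int a - mnm_int b = restr_sigma L w ->
  exists u v, [/\ mnm_off u = a, mnm_off v = b & mnm_int u - mnm_int v = w].
Proof.
move=> ab; exists (mnm_map e a + mnm_on (mpospart w))%MM.
exists (mnm_map e b + mnm_on (mpospart (- w)))%MM.
rewrite !mnm_offD !mnm_off_map !mnm_off_on !addm0; split=> //.
have /rowP wE := mpospartB w; apply/rowP => i; have := wE i.
rewrite !mxE !mnmDE ![mnm_on _ i]mnmE.
case: (boolP (i \in sigma)) => [iS|/notin_sigmaP[j ->] _].
  by rewrite !mnm_map_sigma.
rewrite !addn0 !(mnm_mapE _ _ enum_val_inj).
by move/rowP/(_ j): ab; rewrite !mxE.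
Qed.

(** Rank is additive: lifts of a basis of the projection and a basis of the kernel
    are together independent, and the two sets of pivots together embed [L]. *)
Lemma sigma_heights (k : fieldType) : exists r1 r2 (U : 'M[int]_(r2, n)),
  [/\ forall i, row i U \in lattice_pure L, int_free U,
      forall w, w \in lattice_pure L -> exists c, w = c *m U,
      ideal_height (lattice_ideal k (lattice_restr L)) r1
    & ideal_height (lattice_ideal k L) (r1 + r2)].
Proof.
have HLr := lattice_restr_closed HL; have HLp := lattice_pure_closed HL.
have [r1 [J1 [U1 [cJ1 LU1 freeU1 genU1 injJ1]]]] := lattice_basis HLr.
have [r2 [J2 [U2 [cJ2 LU2 freeU2 genU2 injJ2]]]] := lattice_basis HLp.
exists r1, r2, U2; split=> //; first exact: (lattice_ideal_height k HLr LU1 _ cJ1).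
have /choice[w wP] : forall i, exists w, w \in L /\ row i U1 = restr_sigma L w.
  by move=> i; have /(lattice_restrP HL)[w Lw Uw] := LU1 i; exists w.
pose W := \matrix_i w i; have WE (c : 'rV_r1) j : (c *m W) 0 (e j) = (c *m U1) 0 j.
  rewrite !mxE; apply: eq_bigr => i _; rewrite mxE; congr (_ * _).
  by have [_ /rowP/(_ j)] := wP i; rewrite !mxE.
apply: (@lattice_ideal_height k n L (e @: J1 :|: J2) _ (col_mx W U2)) => //.
- move=> i; case: (split_ordP i) => i' ->.
    by rewrite rowKu rowK; case: (wP i').
  by rewrite rowKd; have /lattice_pureP[] := LU2 i'.
- move=> c; rewrite -[c]hsubmxK mul_row_col => cWU.
  have c1 : lsubmx c = 0.
    apply: freeU1; apply/rowP => j; rewrite -WE [RHS]mxE.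
    have := congr1 (fun v : 'rV_n => v 0 (e j)) cWU; rewrite /= [LHS]mxE [RHS]mxE => <-.
    have /lattice_pureP[_ ->] : rsubmx c *m U2 \in lattice_pure L.
    + exact: zmod_closed_mulmx.
    + by rewrite addr0.
    by apply/notin_sigmaP; exists j.
  by move: cWU; rewrite c1 mul0mx add0r => /freeU2->; rewrite row_mx0.
- rewrite (leq_trans (leq_card_setU _ _)) // leq_add //.
  by rewrite (leq_trans (leq_imset_card _ _)).
move=> u Lu u0; have ru0 : restr_sigma L u = 0.
  apply: injJ1 => [|j jJ]; first by apply/lattice_restrP => //; exists u.
  by rewrite restr_sigmaE u0 // inE imset_f.
apply: injJ2 => [|j jJ]; last by rewrite u0 // inE jJ orbT.
apply/lattice_pureP; split=> // i /notin_sigmaP[j ->].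
by rewrite -restr_sigmaE ru0 mxE.
Qed.

End SigmaMonomials.

(** * From [L] to its projection off sigma *)

Section Forward.
Variables (k : fieldType) (n : nat) (L : {pred 'rV[int]_n}).
Hypothesis HL : zmod_closed L.

Local Notation sigma := (lattice_sigma L).
Local Notation m := #|~: sigma|.
Local Notation e := (@enum_val _ (mem (~: sigma))).

(** The substitution of [1] for the variables of sigma. *)
Definition eval_sigma : {mpoly k[n]} -> {mpoly k[m]} :=
  mmap (@mpolyC m k) (fun i => if [pick j | e j == i] is Some j then 'X_j else 1).

Lemma eval_sigmaB : {morph eval_sigma : f g / f - g}.
Proof. exact: raddfB. Qed.

Lemma eval_sigmaX u : eval_sigma 'X_[u] = 'X_[mnm_off L u].
Proof.
rewrite /eval_sigma mmapX /mmap1 (bigID (mem (~: sigma))) /= [X in _ * X]big1.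
  rewrite mulr1 big_enum_val mpolyXE_id; apply: eq_bigr => j _; rewrite mnmE.
  by case: pickP => [l /eqP/enum_val_inj->//|/(_ j)]; rewrite eqxx.
move=> i iS; case: pickP => [j /eqP ji|_]; last by rewrite expr1n.
by move: iS; rewrite -ji enum_valP.
Qed.

Section Generators.
Variables (h : nat) (u v : 'I_h -> 'X_{1..n}).
Let b i : {mpoly k[n]} := 'X_[u i] - 'X_[v i].
Hypothesis bE : lattice_ideal k L =i ideal_gen [pred f in [seq b i | i : 'I_h]].

Definition on_sigma : {set 'I_h} :=
  [set i | (mnm_off L (u i) == 0%MM) && (mnm_off L (v i) == 0%MM)].

Lemma generator_in_lattice i : mnm_int (u i) - mnm_int (v i) \in L.
Proof.
rewrite -(binomial_in_lattice_ideal k) // bE; apply: sub_ideal_gen.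
by rewrite inE; apply/mapP; exists i; rewrite ?mem_enum.
Qed.

Definition on_sigma_moves : 'M[int]_(#|on_sigma|, n) :=
  \matrix_i (mnm_int (u (enum_val i)) - mnm_int (v (enum_val i))).

(** A monomial congruent to [1] modulo the lattice ideal is reached from [1] by
    moves [u i <-> v i]; every monomial on the way is supported on sigma, so only
    the generators supported on sigma are used. *)
Lemma nonneg_on_sigma_moves w : w \in L -> (forall i, 0 <= w 0 i) ->
  exists c, w = c *m on_sigma_moves.
Proof.
move=> Lw w0; pose p a := `[< exists c, mnm_int a = c *m on_sigma_moves >].
have off0 a : mnm_int a \in L -> mnm_off L a = 0%MM.
  move=> La; apply/mnm_off_eq0 => i iS; have := nonneg_notin_sigma La _ iS.
  by rewrite mxE => H; apply/eqP; rewrite -eqz_nat H // => j; rewrite mxE.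
have DL c : c *m on_sigma_moves \in L.
  by apply: zmod_closed_mulmx => // i; rewrite rowK generator_in_lattice.
have [L0 LB] := HL; have [_ LD] := GRing.zmod_closedD HL.
have pS : {in [pred f in [seq b i | i : 'I_h]], forall f, exists u v,
    f = 'X_[u] - 'X_[v] /\ forall c, p (c + u)%MM = p (c + v)%MM}.
  move=> _ /mapP[i _ ->]; exists (u i), (v i); split=> // c.
  have [iS|iS] := boolP (i \in on_sigma).
    have iE : mnm_int (u i) - mnm_int (v i) =
        delta_mx 0 (enum_rank_in iS i) *m on_sigma_moves.
      by rewrite -rowE rowK enum_rankK_in.
    apply/asboolP/asboolP => -[d dE].
      exists (d - delta_mx 0 (enum_rank_in iS i)); rewrite mulmxBl -dE -iE !mnm_intD.
      by apply/rowP => l; rewrite !mxE; ring.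
    exists (d + delta_mx 0 (enum_rank_in iS i)); rewrite mulmxDl -dE -iE !mnm_intD.
    by apply/rowP => l; rewrite !mxE; ring.
  have Lcuv : mnm_int (c + u i) \in L = (mnm_int (c + v i) \in L).
    by rewrite -[mnm_int (c + u i)]subr0 -[mnm_int (c + v i)]subr0
      (lattice_binomialD _ _ HL (generator_in_lattice i)).
  have Lcu : mnm_int (c + u i) \notin L.
    apply: contra iS => Lcu; have Lcv := Lcu; rewrite Lcuv in Lcv.
    move: (off0 _ Lcu) (off0 _ Lcv); rewrite inE !mnm_offD => /eqP + /eqP.
    by rewrite !mnmD_eq0 => /andP[_ ->] /andP[_ ->].
  have pL a : mnm_int a \notin L -> p a = false.
    by move=> La; apply/asboolP => -[d dE]; case/negP: La; rewrite dE.
  by rewrite !pL // -Lcuv.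
have : p (mpospart w) = p 0%MM.
  have : 'X_[mpospart w] - 'X_[0%MM] \in lattice_ideal k L.
    by rewrite binomial_in_lattice_ideal // mnm_int0 subr0 mnm_int_mpospart.
  rewrite bE => /(mcoefsum_ideal_gen pS)/eqP.
  rewrite raddfB /= !mcoefsumX subr_eq0.
  by case: (p _) (p _) => [] [] //; rewrite ?oner_eq0 // eq_sym oner_eq0.
have -> : p 0%MM by apply/asboolP; exists 0; rewrite mnm_int0 mul0mx.
by move=> /asboolP[c]; rewrite mnm_int_mpospart //; exists c.
Qed.

Lemma pure_on_sigma_moves w : w \in lattice_pure L -> exists c, w = c *m on_sigma_moves.
Proof.
move=> /lattice_pureP[Lw w0]; have [z Lz [z1 z0]] := positive_on_sigma HL.
have [|N wN] := @nonneg_shift _ L w z z1 _ z0; first by move=> i /w0->.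
have LzN : N%:Z *: z \in L by exact: zmod_closed_scale.
have [|c cE] := nonneg_on_sigma_moves LzN.
  move=> i; rewrite mxE mulr_ge0 //.
  by have [/z1/ltW//|/z0->] := boolP (i \in sigma).
have [|d dE] := nonneg_on_sigma_moves _ wN.
  exact: (GRing.zmod_closedD HL).2.
by exists (d - c); rewrite mulmxBl -cE -dE addrK.
Qed.

(** Setting the variables of sigma to [1] kills the generators supported on sigma. *)
Lemma lattice_restr_generators :
  lattice_ideal k (lattice_restr L) =i
  ideal_gen [pred f in [seq eval_sigma (b i) | i in ~: on_sigma]].
Proof.
move=> f; apply/idP/idP; move: f; last first.
  apply: ideal_gen_min; first exact: ideal_gen_closed.
  move=> _ /mapP[i _ ->]; rewrite eval_sigmaB !eval_sigmaX lattice_ideal_binomial //.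
  rewrite !mnm_int_off; apply/lattice_restrP => //.
  exists (mnm_int (u i) - mnm_int (v i)); first exact: generator_in_lattice.
  by apply/rowP => j; rewrite !mxE.
apply: lattice_ideal_min; first exact: ideal_gen_closed.
move=> x y /(lattice_restrP HL)[w Lw /mnm_off_lift[U [V [<- <- UVw]]]].
have : 'X_[U] - 'X_[V] \in lattice_ideal k L by rewrite lattice_ideal_binomial ?UVw.
rewrite bE => /ideal_genP[s sb]; rewrite -!eval_sigmaX -eval_sigmaB => ->.
have -> : eval_sigma (\sum_(p <- s) p.1 * p.2) =
    \sum_(p <- s) eval_sigma p.1 * eval_sigma p.2.
  by rewrite /eval_sigma raddf_sum; apply: eq_bigr => p _; exact: rmorphM.
apply: (ideal_closed_sum (ideal_gen_closed _)) => -[q g] /sb /mapP[i _ /= ->] _.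
apply: (ideal_closedM (ideal_gen_closed _)).
have [iS|iS] := boolP (i \in on_sigma); last first.
  apply: sub_ideal_gen; rewrite inE; apply/mapP; exists i => //.
  by rewrite mem_enum inE.
rewrite /b eval_sigmaB !eval_sigmaX; move: iS; rewrite inE.
by move=> /andP[/eqP-> /eqP->]; rewrite subrr; exact: (ideal_gen_closed _).1.
Qed.

End Generators.

(** Of the [r1 + r2] generators, at least [r2] are supported on sigma since their
    moves generate a lattice of rank [r2]. The images of the others number at most
    [r1]. *)
Lemma complete_intersection_restr :
  binomial_complete_intersection (lattice_ideal k L) ->
  complete_intersection (lattice_ideal k (lattice_restr L)).
Proof.
move=> [h [hth [g [gbin gE]]]].
have [r1 [r2 [U [LU freeU genU ht1 ht2]]]] := sigma_heights HL k.
have {hth} def_h : h = (r1 + r2)%N := ideal_height_unique hth ht2.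
have /choice[uv uvP] : forall i : 'I_h, exists uv : 'X_{1..n} * 'X_{1..n},
    tnth g i = 'X_[uv.1] - 'X_[uv.2].
  by move=> i; have [x [y [_ ->]]] := gbin _ (mem_tnth i g); exists (x, y).
pose u i := (uv i).1; pose v i := (uv i).2.
have bE : lattice_ideal k L =i ideal_gen [pred f in [seq 'X_[u i] - 'X_[v i] | i : 'I_h]].
  move=> f; rewrite gE; congr (f \in ideal_gen _); apply/funext => q.
  apply/tnthP/mapP => [[i ->]|[i _ ->]]; exists i; rewrite ?mem_enum //; exact: uvP.
have le2 : (r2 <= #|on_sigma u v|)%N.
  have /choice[c cP] : forall i, exists c, row i U = c *m on_sigma_moves u v.
    by move=> i; apply: (pure_on_sigma_moves bE); exact: LU.
  apply: (int_free_leq (C := \matrix_i c i) (D := on_sigma_moves u v) freeU).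
  by apply/row_matrixP => i; rewrite row_mul rowK cP.
exists r1; split=> //.
pose s := [seq eval_sigma ('X_[u i] - 'X_[v i]) | i in ~: on_sigma u v].
have sr : (size s <= r1)%N.
  rewrite size_map -cardE -(leq_add2l #|on_sigma u v|) cardsC card_ord.
  by rewrite [leqLHS]def_h addnC leq_add2r.
have tr : size (s ++ nseq (r1 - size s) 0) == r1 by rewrite size_cat size_nseq subnKC.
exists (Tuple tr) => f; rewrite (lattice_restr_generators bE).
apply/idP/idP; move: f; apply: ideal_gen_min; try exact: ideal_gen_closed.
  by move=> f fs; apply: sub_ideal_gen; rewrite inE mem_cat; apply/orP; left.
move=> f; rewrite inE mem_cat => /orP[fs|]; first exact: sub_ideal_gen.
by move=> /nseqP[-> _]; exact: (ideal_gen_closed _).1.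
Qed.

End Forward.

(** * From the projection off sigma back to [L] *)

Section Congruence.
Variables (k : fieldType) (n : nat) (J : {pred {mpoly k[n]}}).
Hypothesis HJ : ideal_closed J.
Implicit Types u v w : 'X_{1..n}.

Definition mcong u v : Prop := 'X_[u] - 'X_[v] \in J.

Lemma mcong_refl u : mcong u u.
Proof. by rewrite /mcong subrr; exact: HJ.1. Qed.

Lemma mcong_sym u v : mcong u v -> mcong v u.
Proof. by move/(ideal_closedM HJ (-1)); rewrite mulN1r opprB. Qed.

Lemma mcong_trans v u w : mcong u v -> mcong v w -> mcong u w.
Proof. by move=> uv /(ideal_closedD HJ uv); rewrite addrA subrK. Qed.

Lemma mcongD w u v : mcong u v -> mcong (w + u)%MM (w + v)%MM.
Proof. by move/(ideal_closedM HJ 'X_[w]); rewrite mulrBr -!mpolyXD. Qed.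

Lemma mcong_sum0 (I : finType) (F : I -> 'X_{1..n}) (c : I -> nat) :
  (forall i, mcong (F i) 0%MM) -> mcong (\sum_i F i *+ c i)%MM 0%MM.
Proof.
move=> F0; elim/big_ind: _ => [|u v u0 v0|i _]; first exact: mcong_refl.
  by apply: mcong_trans (mcongD u v0) _; rewrite addm0.
elim: (c i) => [|d IHd]; first by rewrite mulm0n; exact: mcong_refl.
by rewrite mulmS; apply: mcong_trans (mcongD _ IHd) _; rewrite addm0.
Qed.

End Congruence.

Section Backward.
Variables (k : fieldType) (n : nat) (L : {pred 'rV[int]_n}).
Hypothesis HL : zmod_closed L.

Local Notation sigma := (lattice_sigma L).
Local Notation m := #|~: sigma|.
Local Notation e := (@enum_val _ (mem (~: sigma))).
Local Notation off := (mnm_off L).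

Section Lift.
Variables (s : seq {mpoly k[m]}) (r : nat) (G : 'M[int]_(r, n)).
Hypothesis sL : {subset s <= lattice_binomial k (lattice_restr L)}.
Hypothesis sE : lattice_ideal k (lattice_restr L) =i ideal_gen [pred f in s].
Hypotheses (LG : forall i, row i G \in L) (G0 : forall i j, 0 <= G i j).
Hypothesis genG : forall w, w \in lattice_pure L -> exists c, w = c *m G.

Section Cong.
Variable J : {pred {mpoly k[n]}}.
Hypothesis HJ : ideal_closed J.
Hypothesis JG : forall i, mcong J (mpospart (row i G)) 0%MM.
Hypothesis Js : forall f, f \in s -> exists u v,
  [/\ f = 'X_[off u] - 'X_[off v], mnm_int u - mnm_int v \in L & mcong J u v].
Hypothesis JL : {subset J <= lattice_ideal k L}.

(** Monomials supported on sigma: two of them that differ by an element of [L]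
    differ by a combination of the rows of [G], and the monomials of these exponents
    are congruent to [1]. *)
Lemma mcong_on_sigma u v : off u = 0%MM -> off v = 0%MM ->
  mnm_int u - mnm_int v \in L -> mcong J u v.
Proof.
move=> u0 v0 Luv; have [|c uvc] := genG (w := mnm_int u - mnm_int v).
  apply/lattice_pureP; split=> // i iS; rewrite !mxE.
  by rewrite (mnm_off_eq0 L u).1 // (mnm_off_eq0 L v).1.
pose F i := mpospart (row i G).
have FE i : mnm_int (F i) = row i G.
  by apply: mnm_int_mpospart => j; rewrite mxE.
pose p := (\sum_i F i *+ mpospart c i)%MM; pose q := (\sum_i F i *+ mpospart (- c) i)%MM.
have /(mcongD HJ u) uq := mcong_sum0 HJ (mpospart (- c)) JG.
have /(mcongD HJ v) vp := mcong_sum0 HJ (mpospart c) JG.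
rewrite addm0 -/q in uq; rewrite addm0 -/p in vp.
apply: (mcong_trans HJ (mcong_sym HJ uq)).
suff -> : (u + q = v + p)%MM by [].
have pq : mnm_int p - mnm_int q = c *m G.
  rewrite !mnm_int_sum -sumrB mulmx_sum_row; apply: eq_bigr => i _.
  rewrite FE -scalerBl; congr (_ *: _).
  by have /rowP/(_ i) := mpospartB c; rewrite !mxE.
apply: mnm_int_inj; rewrite !mnm_intD.
by rewrite -[mnm_int u](subrK (mnm_int v)) uvc -pq addrAC subrK addrC.
Qed.


(** A monomial supported on sigma divides one that is congruent to [1], namely a
    large multiple of an exponent vector of [L] that is positive on sigma. *)
Lemma mcong_cancel c u v : off c = 0%MM -> mcong J (c + u)%MM (c + v)%MM -> mcong J u v.
Proof.
move=> c0 cuv; have [z Lz [z1 z0]] := positive_on_sigma HL.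
have [|N wN] := @nonneg_shift _ L (- mnm_int c) z z1 _ z0.
  by move=> i iS; rewrite !mxE (mnm_off_eq0 L c).1.
pose w := mpospart (- mnm_int c + N%:Z *: z).
have wcE : mnm_int (w + c)%MM = N%:Z *: z.
  by rewrite mnm_intD mnm_int_mpospart // addrC addrA subrr add0r.
have wc0 : mcong J (w + c)%MM 0%MM.
  apply: mcong_on_sigma; last by rewrite wcE mnm_int0 subr0 zmod_closed_scale.
    apply/mnm_off_eq0 => i iS; have /rowP/(_ i) := wcE.
    by rewrite !mxE z0 // mulr0 => -[].
  by apply/mnm_off_eq0 => i _; rewrite mnm0E.
have shift x : mcong J x (w + (c + x))%MM.
  apply: (mcong_sym HJ); have := mcongD HJ x wc0.
  by rewrite addm0 addmC -addmA.
apply: (mcong_trans HJ (shift u)); apply: (mcong_trans HJ (mcongD HJ w cuv)).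
exact: mcong_sym HJ _ _ (shift v).
Qed.

(** Off sigma, [u] and [v] are connected by the moves of [s]. Each of them lifts to a
    congruence at the expense of factors supported on sigma, so [u] and [v] become
    congruent after multiplication by monomials [x] and [y] supported on sigma; as
    [J] is contained in the lattice ideal, these can be compared by
    [mcong_on_sigma] and cancelled. *)
Lemma mcong_lattice u v : mnm_int u - mnm_int v \in L -> mcong J u v.
Proof.
move=> Luv; pose p (a : 'X_{1..m}) := `[< exists c d, [/\ off c = 0%MM, off d = 0%MM &
  mcong J (mnm_map e a + c)%MM (mnm_map e (off v) + d)%MM] >].
(* The class [p] of monomials off sigma is closed under the moves of [s]. *)
have pD c U V : mcong J U V -> p (c + off U)%MM -> p (c + off V)%MM.
  move=> UV /asboolP[x [y [x0 y0 xy]]]; apply/asboolP.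
  exists (x + mnm_on L V)%MM, (y + mnm_on L U)%MM.
  rewrite !mnm_offD !mnm_off_on x0 y0 !addm0; split=> //.
  have -> : (mnm_map e (c + off V) + (x + mnm_on L V) = mnm_map e c + x + V)%MM.
    rewrite -[in RHS](mnm_off_onK L V) mnm_mapD.
    by apply/mnmP => i; rewrite !mnmDE; lia.
  apply: (mcong_trans HJ (mcongD HJ _ (mcong_sym HJ UV))).
  have -> : (mnm_map e c + x + U = mnm_on L U + (mnm_map e (c + off U) + x))%MM.
    rewrite -[in LHS](mnm_off_onK L U) mnm_mapD.
    by apply/mnmP => i; rewrite !mnmDE; lia.
  apply: (mcong_trans HJ (mcongD HJ _ xy)).
  by rewrite addmC -addmA; exact: mcong_refl.
have pS : {in [pred f in s], forall f, exists u v,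
    f = 'X_[u] - 'X_[v] /\ forall c, p (c + u)%MM = p (c + v)%MM}.
  move=> f /Js[U [V [-> _ UV]]]; exists (off U), (off V); split=> // c.
  by apply/idP/idP; apply: pD => //; exact: mcong_sym.
have /asboolP[x [y [x0 y0 xy]]] : p (off u).
  have : 'X_[off u] - 'X_[off v] \in lattice_ideal k (lattice_restr L).
    rewrite lattice_ideal_binomial //; apply/lattice_restrP => //.
    exists (mnm_int u - mnm_int v) => //.
    by rewrite !mnm_int_off; apply/rowP => j; rewrite !mxE.
  rewrite sE => /(mcoefsum_ideal_gen pS); rewrite raddfB /= !mcoefsumX.
  have -> : p (off v).
    have off0 : off 0 = 0%MM by apply/mnm_off_eq0 => i _; rewrite mnm0E.
    by apply/asboolP; exists 0%MM, 0%MM; split=> //; exact: mcong_refl.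
  by case: (p (off u)) => // /eqP; rewrite sub0r oppr_eq0 oner_eq0.
apply: (mcong_cancel x0).
have -> : (x + u = mnm_map e (off u) + x + mnm_on L u)%MM.
  rewrite -[in LHS](mnm_off_onK L u); by apply/mnmP => i; rewrite !mnmDE; lia.
have -> : (x + v = mnm_map e (off v) + (x + mnm_on L v))%MM.
  rewrite -[in LHS](mnm_off_onK L v); by apply/mnmP => i; rewrite !mnmDE; lia.
have := mcongD HJ (mnm_on L u) xy; rewrite addmC => H.
apply: (mcong_trans HJ H); rewrite addmC -addmA; apply: (mcongD HJ).
apply: mcong_on_sigma; rewrite ?mnm_offD ?x0 ?y0 ?mnm_off_on ?addm0 //.
have := JL xy; rewrite binomial_in_lattice_ideal // => Lxy.
have := HL.2 _ _ Luv Lxy; congr (_ \in L).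
have onE w : mnm_int w = mnm_int (mnm_map e (off w)) + mnm_int (mnm_on L w).
  by rewrite -mnm_intD mnm_off_onK.
rewrite [mnm_int u]onE [mnm_int v]onE !mnm_intD.
by apply/rowP => i; rewrite !mxE; ring.
Qed.

End Cong.
(** The generators are lifts of those in [s], and [x^g - 1] for the rows [g] of [G]. *)
Lemma lattice_ideal_lift_generators : exists t : seq {mpoly k[n]},
  [/\ (size t <= size s + r)%N, {subset t <= lattice_binomial k L}
    & lattice_ideal k L =i ideal_gen [pred f in t]].
Proof.
have /choice[U UP] : forall f, exists U : 'X_{1..n} * 'X_{1..n}, f \in s ->
    f = 'X_[off U.1] - 'X_[off U.2] /\ mnm_int U.1 - mnm_int U.2 \in L.
  move=> f; have [fs|_] := boolP (f \in s); last by exists (0, 0)%MM.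
  have /asboolP[a [b [/(lattice_restrP HL)[w Lw ab] ->]]] := sL fs.
  have [u [v [<- <- uv]]] := mnm_off_lift ab.
  by exists (u, v) => _; rewrite uv.
pose t := [seq 'X_[(U f).1] - 'X_[(U f).2] | f <- s] ++
  [seq 'X_[mpospart (row i G)] - 'X_[0%MM] | i : 'I_r] : seq {mpoly k[n]}.
have tL : {subset t <= lattice_binomial k L}.
  move=> f; rewrite mem_cat => /orP[/mapP[g gs ->]|/mapP[i _ ->]]; apply/asboolP.
    by exists (U g).1, (U g).2; split=> //; case: (UP g gs).
  exists (mpospart (row i G)), 0%MM; split=> //.
  rewrite mnm_int0 subr0 mnm_int_mpospart ?LG // => j.
  by rewrite mxE.
have HJ := ideal_gen_closed [pred f in t].
have JL : {subset ideal_gen [pred f in t] <= lattice_ideal k L}.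
  apply: ideal_gen_min => [|f /tL]; [exact: ideal_gen_closed|exact: sub_ideal_gen].
exists t; split=> // [|f]; first by rewrite size_cat !size_map -enumT size_enum_ord.
apply/idP/idP; [move: f|exact: JL]; apply: lattice_ideal_min => // u v.
apply: mcong_lattice => // [i|f fs].
  apply: sub_ideal_gen; rewrite inE mem_cat; apply/orP; right.
  by apply/mapP; exists i; rewrite ?mem_enum.
have [fE LU] := UP f fs; exists (U f).1, (U f).2; split=> //.
apply: sub_ideal_gen; rewrite inE mem_cat; apply/orP; left.
by apply/mapP; exists f.
Qed.

End Lift.
(** Zero generators are dropped and a known binomial is repeated to reach the
    required number. *)
Lemma binomial_tuple_generators (I : {pred {mpoly k[n]}}) (t : seq {mpoly k[n]}) h :
  {subset t <= lattice_binomial k L} -> (size t <= h)%N ->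
  I =i ideal_gen [pred f in t] ->
  (exists2 b : {mpoly k[n]}, b \in I & (0 < h)%N -> is_binomial b) ->
  exists g : h.-tuple {mpoly k[n]},
    {in g, forall f, is_binomial f} /\ I =i ideal_gen [pred f in g].
Proof.
move=> tL th It [b Ib hb]; pose t' := [seq f <- t | f != 0].
have t'h : (size t' <= h)%N by rewrite (leq_trans _ th) // size_filter count_size.
have gh : size (t' ++ nseq (h - size t') b) == h by rewrite size_cat size_nseq subnKC.
exists (Tuple gh); split=> [f|f].
  rewrite mem_cat mem_filter => /orP[/andP[f0 /tL/asboolP[u [v [_ fE]]]]|].
    exists u, v; split=> //; apply: contraNneq f0 => uv.
    by rewrite fE uv subrr.
  move=> /nseqP[-> lt0]; apply: hb; apply: leq_trans lt0 _; exact: leq_subr.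
rewrite It; apply/idP/idP; move: f; apply: ideal_gen_min; try exact: ideal_gen_closed.
  move=> f ft; have [->|f0] := eqVneq f 0; first exact: (ideal_gen_closed _).1.
  by apply: sub_ideal_gen; rewrite inE mem_cat mem_filter f0 ft.
move=> f; rewrite inE mem_cat mem_filter => /orP[/andP[_ ft]|/nseqP[-> _]].
  exact: sub_ideal_gen.
by rewrite -It.
Qed.

(** A binomial to pad the list of generators exists unless [L] is zero, and then the
    height is zero. *)
Lemma binomial_complete_intersection_lift :
  complete_intersection (lattice_ideal k (lattice_restr L)) ->
  binomial_complete_intersection (lattice_ideal k L).
Proof.
move=> [r [htr [g gE]]].
have [r1 [r2 [U [LU freeU genU ht1 ht2]]]] := sigma_heights HL k.
have def_r := ideal_height_unique htr ht1; subst r.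
have [s [sr sL sE]] := lattice_ideal_binomial_generators (lattice_restr_closed HL)
  (lattice_restr_pointed HL) gE.
have [G [LG G0 genG]] := nonneg_basis HL LU genU.
have [t [tr tL tE]] := lattice_ideal_lift_generators sL sE LG G0 genG.
exists (r1 + r2)%N; split=> //; apply: binomial_tuple_generators tL _ tE _.
  by rewrite (leq_trans tr) // leq_add2r.
have [[w Lw w0]|L0] := pselect (exists2 w, w \in L & w != 0).
  exists ('X_[mpospart w] - 'X_[mpospart (- w)]).
    by rewrite lattice_ideal_binomial // mpospartB.
  move=> _; exists (mpospart w), (mpospart (- w)); split=> //.
  by apply: contraNneq w0 => ww; rewrite -(mpospartB w) ww subrr.
exists 0; first exact: (ideal_gen_closed _).1.
suff ht0 : ideal_height (lattice_ideal k L) 0.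
  by rewrite (ideal_height_unique ht2 ht0).
apply: (@lattice_ideal_height k n L set0 0 0) => //; rewrite ?cards0 //.
- by case.
- by move=> c _; rewrite [c]thinmx0.
- by move=> u Lu _; apply: contrapT => /eqP u0; apply: L0; exists u.
Qed.

End Backward.

Theorem theorem5p5 (k : fieldType) (n : nat) (L : {pred 'rV[int]_n})
    (HL : zmod_closed L) :
  binomial_complete_intersection (lattice_ideal k L) <->
  complete_intersection (lattice_ideal k (lattice_restr L)).
Proof.
split; first exact: complete_intersection_restr.
exact: binomial_complete_intersection_lift.
Qed.
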